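(* Let $P_\sigma(n)$ be defined by $\sum_{n=0}^{\infty}P_\sigma(n)q^n=\sigma(q)$, where $\sigma(q)=\sum_{n=0}^{\infty}\dfrac{q^{(n+1)(n+2)/2}(-q;q)_n}{(q;q^2)_{n+1}}$. Then for every integer $n\ge 0$, $$P_\sigma(2n+1)={P_\sigma}_{(d,e)}(n)-{P_\sigma}_{(d,o)}(n),$$ where ${P_\sigma}_{(d,e)}(n)$ (respectively ${P_\sigma}_{(d,o)}(n)$) denotes the number of partitions of $n$, all of whose parts are congruent to $0,1,3$ or $5\pmod 6$, such that (i) parts congruent to $1,5\pmod 6$ have two colours; (ii) parts congruent to $3\pmod 6$ have three colours; (iii) parts congruent to $0\pmod 6$ are distinct and have one colour; (iv) the number of parts congruent to $0\pmod 6$ is even (respectively odd).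
   Context: Notation: $(b;q)_n=\prod_{k=0}^{n-1}(1-bq^k)$. Identities involving $q$ are between formal power series. Saying that a part has $r$ colours means that each part of that size may appear in any of $r$ distinct colours, and parts of the same size with different colours are considered distinct (colour partitions); parts may be repeated unless declared distinct. The empty partition is the only partition of $0$. *)

(* Defs.v *)
From HB Require Import structures.
From mathcomp Require Import all_boot all_order all_algebra.
Set Implicit Arguments.
Unset Strict Implicit.
Unset Printing Implicit Defensive.
Import GRing.Theory.
Local Open Scope ring_scope.

(* A formal power series in q over R is its sequence of coefficients. *)
Definition fps (R : Type) := nat -> R.

Definition fps_of_poly (R : nzSemiRingType) (p : {poly R}) : fps R :=
  fun i => p`_i.

Definition fps_mul (R : pzSemiRingType) (f g : fps R) : fps R :=
  fun N => \sum_(i < N.+1) f i * g (N - i)%N.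

(* The first n coefficients of f / g, obtained by solving g * h = f degree by
   degree. *)
Fixpoint fps_quo_seq (R : comUnitRingType) (f g : fps R) (n : nat) : seq R :=
  if n is k.+1 then
    let s := fps_quo_seq f g k in
    rcons s ((f k - \sum_(i < k) s`_i * g (k - i)%N) / g 0%N)
  else [::].

(* f / g, meaningful when the constant coefficient of g is a unit; see
   fps_quoK and fps_quo_unique. *)
Definition fps_quo (R : comUnitRingType) (f g : fps R) : fps R :=
  fun N => (fps_quo_seq f g N.+1)`_N.

(* S = \sum_(n >= 0) F n in the topology of formal power series: every
   coefficient of the partial sums is eventually equal to that of S. *)
Definition fps_has_sum (R : nmodType) (F : nat -> fps R) (S : fps R) : Prop :=
  forall N : nat, exists M : nat, forall m : nat, (M <= m)%N ->
    \sum_(n < m) F n N = S N.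

(* (b; q)_n *)
Definition qpoch (R : pzRingType) (b q : R) (n : nat) : R :=
  \prod_(k < n) (1 - b * q ^+ k).

Definition sigma_term (n : nat) : fps int :=
  fps_quo
    (fps_of_poly ('X^((n.+1 * n.+2) %/ 2) * qpoch (- 'X) 'X n : {poly int}))
    (fps_of_poly (qpoch 'X ('X^2) n.+1 : {poly int})).

(* A multiset of parts of sizes 1, ..., n in colours 0, 1, 2, given by its
   multiplicities: m (i, c) is the number of parts of size i.+1 and colour c.
   No partition of n has a part, or a multiplicity, larger than n. *)
Definition coloured_parts (n : nat) := {ffun 'I_n * 'I_3 -> 'I_n.+1}.

(* The number of colours available to parts of size k; 0 if k is not an
   admissible part. *)
Definition nb_colours (k : nat) : nat :=
  match (k %% 6)%N with
  | 0 => 1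
  | 1 | 5 => 2
  | 3 => 3
  | _ => 0
  end%N.

Definition sigma_partition (n : nat) (m : coloured_parts n) : bool :=
  [&& (\sum_(x : 'I_n * 'I_3) m x * x.1.+1 == n)%N,
      [forall x : 'I_n * 'I_3, (0 < m x)%N ==> (x.2 < nb_colours x.1.+1)%N]
    & [forall x : 'I_n * 'I_3, (6 %| x.1.+1)%N ==> (m x <= 1)%N]].

Definition nb_parts0mod6 (n : nat) (m : coloured_parts n) : nat :=
  (\sum_(x : 'I_n * 'I_3 | 6 %| x.1.+1) m x)%N.

Definition P_sigma_de (n : nat) : nat :=
  #|[set m : coloured_parts n | sigma_partition m & ~~ odd (nb_parts0mod6 m)]|.

Definition P_sigma_do (n : nat) : nat :=
  #|[set m : coloured_parts n | sigma_partition m & odd (nb_parts0mod6 m)]|.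

Lemma size_fps_quo_seq (R : comUnitRingType) (f g : fps R) n :
  size (fps_quo_seq f g n) = n.
Proof. by elim: n => //= n IHn; rewrite size_rcons IHn. Qed.

Lemma nth_fps_quo_seq (R : comUnitRingType) (f g : fps R) n i :
  (i < n)%N -> (fps_quo_seq f g n)`_i = fps_quo f g i.
Proof.
elim: n => // n IHn; rewrite ltnS leq_eqVlt => /predU1P[-> //|lt_in].
by rewrite [LHS]nth_rcons size_fps_quo_seq lt_in IHn.
Qed.

Lemma fps_quoE (R : comUnitRingType) (f g : fps R) N :
  fps_quo f g N =
    (f N - \sum_(i < N) fps_quo f g i * g (N - i)%N) / g 0%N.
Proof.
rewrite {1}/fps_quo /= nth_rcons size_fps_quo_seq ltnn eqxx.
congr ((_ - _) / _); apply: eq_bigr => i _.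
by rewrite nth_fps_quo_seq.
Qed.

Lemma fps_quoK (R : comUnitRingType) (f g : fps R) :
  g 0%N \is a GRing.unit -> fps_mul (fps_quo f g) g =1 f.
Proof.
move=> g0U N; rewrite /fps_mul big_ord_recr /= subnn fps_quoE divrK //.
by rewrite addrC subrK.
Qed.

Lemma fps_quo_unique (R : comUnitRingType) (f g h : fps R) :
  g 0%N \is a GRing.unit -> fps_mul h g =1 f -> h =1 fps_quo f g.
Proof.
move=> g0U hg N; elim/ltn_ind: N => N IHN; rewrite fps_quoE -hg /fps_mul.
rewrite big_ord_recr /= subnn [X in _ - X](eq_bigr (fun i : 'I_N =>
  h i * g (N - i)%N)); last by move=> i _; rewrite IHN.
by rewrite addrC addrK mulrK.
Qed.

Lemma fps_quo_eq0 (R : comUnitRingType) (f g : fps R) d N :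
  (forall i, (i < d)%N -> f i = 0) -> (N < d)%N -> fps_quo f g N = 0.
Proof.
move=> f0; elim/ltn_ind: N => N IHN ltNd.
rewrite fps_quoE f0 // big1 ?subr0 ?mul0r // => i _.
by rewrite IHN ?mul0r // (ltn_trans _ ltNd).
Qed.

Lemma qpoch_coef0 n : (qpoch 'X ('X^2) n : {poly int})`_0 = 1.
Proof.
rewrite -horner_coef0 /qpoch horner_prod big1 // => k _.
by rewrite !hornerE ?mul0r ?subr0.
Qed.

Lemma sigma_termK n :
  fps_mul (sigma_term n) (fps_of_poly (qpoch 'X ('X^2) n.+1)) =1
  fps_of_poly ('X^((n.+1 * n.+2) %/ 2) * qpoch (- 'X) 'X n).
Proof. by apply: fps_quoK; rewrite /fps_of_poly qpoch_coef0 unitr1. Qed.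

Lemma fps_has_sum_unique (R : nmodType) (F : nat -> fps R) (S T : fps R) :
  fps_has_sum F S -> fps_has_sum F T -> S =1 T.
Proof.
move=> FS FT N; have [M1 FS1] := FS N; have [M2 FT2] := FT N.
by rewrite -(FS1 (maxn M1 M2)) ?leq_maxl // -(FT2 (maxn M1 M2)) ?leq_maxr.
Qed.

Lemma sigma_summable : exists P : fps int, fps_has_sum sigma_term P.
Proof.
exists (fun N => \sum_(n < N) sigma_term n N) => N; exists N => m leNm.
rewrite -!(big_mkord xpredT (fun n => sigma_term n N)) (@big_cat_nat _ _ _ N 0 m) //=.
rewrite [X in _ + X]big_nat_cond [X in _ + X]big1 ?addr0 // => n.
rewrite andbT => /andP[leNn _].
apply: (@fps_quo_eq0 _ _ _ n.+1) => // i lt_in.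
rewrite /fps_of_poly coefXnM (leq_trans lt_in) //.
by rewrite leq_divRL // leq_mul2l /= !ltnS leq0n.
Qed.

(* Main.v *)
Require Import Defs.
From mathcomp Require Import all_boot all_order all_algebra.
From mathcomp Require Import boolp classical_sets functions fsbigop.
From mathcomp Require Import ring zify.
From mathcomp Require Import qpoly.

(** The even part of sigma(q) is mock, but its odd part is an infinite product.
With p = q^2, the signed count of the theorem has generating function
C(p) = (p^6;p^6) / ((p,p^5;p^6)^2 (p^3;p^6)^3), all products being infinite, and
the claim is that sigma(q) - sigma(-q) = 2 q C(q^2).

All identities are proved in a commutative ring in which q is nilpotent; there
every infinite sum or product is finite, 1 - q^v is invertible, and both q and -q
can be substituted. The ring Z[X]/(X^(2n+2)) then gives the coefficient of
q^(2n+1).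

From sigma to a double sum. The denominators 1/(q;q^2)_(n+1) form, relative to
a = q, a Bailey pair whose other member is a short sum of powers of q
([bailey_sumP]). Summed against the matching conjugate pair ([conjugate_pair], a
limit of the q-Gauss sum) it gives
((q;q) / (-q;q)) sigma(q) = sum_(r >= 1) (-1)^(r-1) q^(r^2) (1 - q^r) U_r, with
U_r = sum_(m < r) q^((2m+1)(r-1-m)), and (q;q) / (-q;q) = sum_n (-1)^n q^(n^2) by
Gauss. The right-hand side, cut along other lines, is g(1) for a series
g(w) = sum_n g_n w^n such that g(w) + q w g(q^2 w) = N(w), where
N(w) = sum_m (-1)^m q^(m^2+m) w^(2m).

From the double sum to an Appell sum. The theta function
Theta(w) = sum_n (-1)^n q^(n^2) w^n solves the homogeneous equation, so that
h = g / Theta satisfies h(w) - h(q^2 w) = N(w) / Theta(w). This quotient has no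
pole: by the quintuple product identity ([quintuple]) it is (1/eta) sum_k e_k w^k
with e_k equal to 0 or to a signed power of q, where eta = (q^2;q^2). Dividing e_k
by 1 - q^(2k) therefore produces a second solution, up to the term k = 0, and two
solutions differ by a combination of Theta(w) and of w Theta'(w), which vanishes at
w = 1. This gives ([sigma_appell])
eta sigma(q) = sum_(k <> 0) e_k / (1 - q^(2k)) + (a series even in q).

The odd part. The exponent of q in e_k has the parity of k, so only odd k survive
in sigma(q) - sigma(-q) ([sigma_odd]). Expanded into geometric series and regrouped
around the diagonal, what is left is the Lambert series
sum_(n in Z) q^(6n+1) / (1 - q^(12n+2)) ([appell_odd_lambert]). The same play
between a theta function and a first order recurrence ([kronecker_eta]), followed
by the partial fraction expansion of 1 / (p,p^5;p^6) ([kronecker_thetaP]), turns it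
into a product, and dividing by eta gives q C(q^2) ([sigma_odd_prod]). *)

Set Implicit Arguments.
Unset Strict Implicit.
Unset Printing Implicit Defensive.
Import Order.TTheory GRing.Theory Num.Theory.
Local Open Scope ring_scope.

(** * Sums with finite support *)

Lemma int_parity (n : int) : {m | n = 2 * m} + {m | n = 2 * m + 1}.
Proof.
have := divz_eq n 2; have : (0 <= (n %% 2)%Z < 2) by rewrite modz_ge0 // ltz_pmod.
case E : ((n %% 2)%Z) => [[|[|r]]|r] H1 H2; try by exfalso; lia.
  by left; exists (n %/ 2)%Z; lia.
by right; exists (n %/ 2)%Z; lia.
Qed.

Section FSum.
Variable A : comNzRingType.
Implicit Types (I J L : choiceType).

(** The sum over the whole index type, equal to 0 when the support is infinite;
series indexed by nat and by int are then handled alike. *)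
Definition fsum I (F : I -> A) : A := \sum_(i \in [set: I]%classic) F i.

Definition fsupp I (F : I -> A) : Prop :=
  exists r : seq I, forall i, i \notin r -> F i = 0.

Lemma fsumE I (r : seq I) (F : I -> A) :
  uniq r -> (forall i, i \notin r -> F i = 0) -> fsum F = \sum_(i <- r) F i.
Proof.
move=> Ur F0; rewrite /fsum (fsbigE r) //; last by move=> i _; exact: F0.
by apply: eq_bigl => i; rewrite in_setT.
Qed.

Lemma fsupp_uniq I (F : I -> A) : fsupp F ->
  exists2 r, uniq r & forall i, i \notin r -> F i = 0.
Proof.
case=> r F0; exists (undup r); first exact: undup_uniq.
by move=> i; rewrite mem_undup; exact: F0.
Qed.

Lemma eq_fsum I (F G : I -> A) : F =1 G -> fsum F = fsum G.
Proof. by move=> /funext ->. Qed.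

Lemma fsum_reindex I J (h : J -> I) (F : I -> A) :
  bijective h -> fsum F = fsum (fun j => F (h j)).
Proof. exact: reindex_fsbigT. Qed.

Lemma fsum0 I (F : I -> A) : (forall i, F i = 0) -> fsum F = 0.
Proof. by move=> F0; rewrite (@fsumE _ [::]) ?big_nil. Qed.

Lemma fsupp2 I (F G : I -> A) : fsupp F -> fsupp G -> exists r,
  [/\ uniq r, forall i, i \notin r -> F i = 0 & forall i, i \notin r -> G i = 0].
Proof.
case=> r F0 [s G0]; exists (undup (r ++ s)); split=> [|i|i].
- exact: undup_uniq.
- by rewrite mem_undup mem_cat negb_or => /andP[/F0].
by rewrite mem_undup mem_cat negb_or => /andP[_ /G0].
Qed.

Lemma fsumD I (F G : I -> A) : fsupp F -> fsupp G ->
  fsum (fun i => F i + G i) = fsum F + fsum G.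
Proof.
move=> Ff Gf; have [r [Ur F0 G0]] := fsupp2 Ff Gf.
rewrite !(@fsumE _ r) ?big_split // => i ir.
by rewrite F0 ?G0 ?addr0.
Qed.

Lemma fsuppD I (F G : I -> A) : fsupp F -> fsupp G -> fsupp (fun i => F i + G i).
Proof.
move=> Ff Gf; have [r [Ur F0 G0]] := fsupp2 Ff Gf.
by exists r => i ir; rewrite F0 ?G0 ?addr0.
Qed.

Lemma fsuppM I (F G : I -> A) : fsupp F -> fsupp (fun i => G i * F i).
Proof. by case=> r F0; exists r => i /F0 ->; rewrite mulr0. Qed.

Lemma fsumMl I (c : A) (F : I -> A) : fsupp F ->
  c * fsum F = fsum (fun i => c * F i).
Proof.
case/fsupp_uniq=> r Ur F0; rewrite !(@fsumE _ r) ?mulr_sumr // => i ir.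
by rewrite F0 ?mulr0.
Qed.

Lemma fsumMr I (c : A) (F : I -> A) : fsupp F ->
  fsum F * c = fsum (fun i => F i * c).
Proof.
by move=> Ff; rewrite mulrC fsumMl //; apply: eq_fsum => i; rewrite mulrC.
Qed.

Lemma fsumN I (F : I -> A) : fsupp F -> fsum (fun i => - F i) = - fsum F.
Proof.
by move=> Ff; rewrite -mulN1r fsumMl //; apply: eq_fsum => i; rewrite mulN1r.
Qed.

Lemma fsumB I (F G : I -> A) : fsupp F -> fsupp G ->
  fsum (fun i => F i - G i) = fsum F - fsum G.
Proof.
move=> Ff Gf; rewrite -fsumN // -fsumD //.
by case: Gf => r G0; exists r => i /G0 ->; rewrite oppr0.
Qed.

Lemma fsuppB I (F G : I -> A) : fsupp F -> fsupp G -> fsupp (fun i => F i - G i).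
Proof.
move=> Ff Gf; have [r [Ur F0 G0]] := fsupp2 Ff Gf.
by exists r => i ir; rewrite F0 ?G0 ?subr0.
Qed.

Lemma fsupp_reindex I J (h : J -> I) (F : I -> A) :
  bijective h -> fsupp F -> fsupp (fun j => F (h j)).
Proof.
move=> [h' hK h'K] [r F0]; exists (map h' r) => j jr; apply: F0.
by apply: contra jr => jr; rewrite -(hK j) map_f.
Qed.

(** Finiteness of the joint support is what makes both iterated sums finite. *)
Lemma fsum_exchange I J (F : I -> J -> A) :
  fsupp (fun x : I * J => F x.1 x.2) ->
  fsum (fun i => fsum (F i)) = fsum (fun j => fsum (F^~ j)).
Proof.
case=> r F0; set r1 := undup (map fst r); set r2 := undup (map snd r).
have F1 i j : i \notin r1 -> F i j = 0.
  rewrite mem_undup => ir; apply: (F0 (i, j)).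
  by apply: contra ir => ijr; apply/mapP; exists (i, j).
have F2 i j : j \notin r2 -> F i j = 0.
  rewrite mem_undup => jr; apply: (F0 (i, j)).
  by apply: contra jr => ijr; apply/mapP; exists (i, j).
rewrite (@fsumE _ r1) ?undup_uniq //; last first.
  by move=> i ir; apply: fsum0 => j; rewrite F1.
rewrite [RHS](@fsumE _ r2) ?undup_uniq //; last first.
  by move=> j jr; apply: fsum0 => i; rewrite F2.
under eq_bigr => i _.
  rewrite (@fsumE _ r2) ?undup_uniq //; last by move=> j jr; rewrite F2.
  over.
rewrite exchange_big /=; apply: eq_bigr => j _.
by rewrite (@fsumE _ r1) ?undup_uniq // => i ir; rewrite F1.
Qed.

Lemma fsupp_fst I J (F : I -> J -> A) :
  fsupp (fun x : I * J => F x.1 x.2) -> fsupp (fun i => fsum (F i)).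
Proof.
case=> r F0; exists (map fst r) => i ir; apply: fsum0 => j.
by apply: (F0 (i, j)); apply: contra ir => ijr; apply/mapP; exists (i, j).
Qed.

Lemma fsupp_snd I J (F : I -> J -> A) i :
  fsupp (fun x : I * J => F x.1 x.2) -> fsupp (F i).
Proof.
case=> r F0; exists (map snd r) => j ir.
by apply: (F0 (i, j)); apply: contra ir => ijr; apply/mapP; exists (i, j).
Qed.

Lemma fsupp_swap I J (F : I -> J -> A) :
  fsupp (fun x : I * J => F x.1 x.2) -> fsupp (fun x : J * I => F x.2 x.1).
Proof.
apply: (@fsupp_reindex _ _ (fun x : J * I => (x.2, x.1)) (fun x => F x.1 x.2)).
by exists (fun x : I * J => (x.2, x.1)) => -[].
Qed.

(** Used with nat + nat and with even + odd as decompositions of int. *)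
Lemma fsum_split I J L (f : I -> L) (g : J -> L) (F : L -> A) :
  injective f -> injective g -> (forall i j, f i != g j) ->
  (forall l, (exists i, l = f i) \/ (exists j, l = g j)) ->
  fsupp (fun i => F (f i)) -> fsupp (fun j => F (g j)) ->
  fsum F = fsum (fun i => F (f i)) + fsum (fun j => F (g j)).
Proof.
move=> fI gI fg fgT /fsupp_uniq[r Ur F0] /fsupp_uniq[s Us G0].
rewrite (@fsumE _ r) // (@fsumE _ s) // (@fsumE _ (map f r ++ map g s)).
- by rewrite big_cat !big_map.
- rewrite cat_uniq !map_inj_uniq // Ur Us andbT /=.
  apply/hasPn => _ /mapP[j js ->]; apply/negP => /mapP[i ir] fgE.
  by move: (fg i j); rewrite fgE eqxx.
move=> l; rewrite mem_cat negb_or => /andP[lf lg].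
case: (fgT l) => -[i li].
  by rewrite li F0 //; apply: contra lf => ir; rewrite li map_f.
by rewrite li G0 //; apply: contra lg => ir; rewrite li map_f.
Qed.

Lemma fsum_nat M (F : nat -> A) : (forall n, (M <= n)%N -> F n = 0) ->
  fsum F = \sum_(i < M) F i.
Proof.
move=> F0; rewrite (@fsumE _ (iota 0 M)) ?iota_uniq //.
  by rewrite -(big_mkord xpredT) /index_iota subn0.
by move=> i; rewrite mem_iota add0n /= -leqNgt; exact: F0.
Qed.

Lemma fsupp_nat M (F : nat -> A) : (forall n, (M <= n)%N -> F n = 0) -> fsupp F.
Proof.
by move=> F0; exists (iota 0 M) => i; rewrite mem_iota /= -leqNgt; exact: F0.
Qed.

Lemma fsupp_nat2 M (F : nat -> nat -> A) :
  (forall m n, (M <= m)%N || (M <= n)%N -> F m n = 0) ->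
  fsupp (fun x : nat * nat => F x.1 x.2).
Proof.
move=> F0; exists (allpairs pair (iota 0 M) (iota 0 M)) => -[m n] /= mn.
apply: F0; apply: contraR mn; rewrite negb_or -!ltnNge => /andP[mM nM].
by apply/allpairsP; exists (m, n); rewrite !mem_iota.
Qed.

Lemma fsum_recl (F : nat -> A) : fsupp F ->
  fsum F = F 0%N + fsum (fun n => F n.+1).
Proof.
case=> r F0; set M := (\max_(i <- r) i).+1.
have F1 n : (M <= n)%N -> F n = 0.
  move=> Mn; apply: F0; apply/negP => nr.
  by move: Mn; rewrite /M ltnNge (@leq_bigmax_seq _ r xpredT id n).
rewrite (@fsum_nat M.+1) => [|n /ltnW/F1 //].
rewrite (@fsum_nat M) => [|n Mn]; last by rewrite F1 // ltnW.
by rewrite big_ord_recl.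
Qed.

(** Turns a triangular sum, constrained by c <= n, into a free one. *)
Lemma fsum_nat_shift c (F : nat -> A) :
  fsum (fun n => if (c <= n)%N then F (n - c)%N else 0) = fsum F.
Proof.
pose D := [set n : nat | (c <= n)%N]%classic.
transitivity (\sum_(n \in D) F (n - c)%N).
  rewrite /fsum [RHS]fsbig_mkcond; apply: eq_fsbigr => n _.
  by rewrite /patch mem_setE.
rewrite (@reindex_fsbig _ _ _ _ _ (addn c) [set: nat]%classic).
  by apply: eq_fsum => n; rewrite addKn.
split=> [n _|m n _ _ /addnI //|n /= cn]; first exact: leq_addr.
by exists (n - c)%N => //; rewrite subnKC.
Qed.

Definition vanish M (F : int -> A) := forall k : int, (M <= `|k|)%N -> F k = 0.

Lemma vanish_fsupp M F : vanish M F -> fsupp F.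
Proof.
move=> F0; exists (map Posz (iota 0 M) ++ map Negz (iota 0 M)) => k.
rewrite mem_cat negb_or => /andP[k1 k2]; apply: F0; rewrite leqNgt.
apply/negP => kM; case: k kM k1 k2 => n /= nM.
  by rewrite map_f // mem_iota.
by move=> _; rewrite map_f // mem_iota; lia.
Qed.

Lemma fsupp_vanish F : fsupp F -> exists M, vanish M F.
Proof.
case=> r F0; exists (\max_(i <- r) `|i|%N).+1 => k kM; apply: F0.
by apply/negP => kr; move: kM; rewrite ltnNge (@leq_bigmax_seq _ r xpredT (fun i :
  int => `|i|%N) k).
Qed.

Lemma vanish_fsupp2 M (F : int -> int -> A) :
  (forall m n : int, (M <= `|m|)%N || (M <= `|n|)%N -> F m n = 0) ->
  fsupp (fun x : int * int => F x.1 x.2).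
Proof.
set r := map Posz (iota 0 M) ++ map Negz (iota 0 M).
have rP (k : int) : (`|k| < M)%N -> k \in r.
  case: k => n nM; rewrite mem_cat.
    by rewrite (map_f Posz) // mem_iota.
  by rewrite (map_f Negz) ?orbT // mem_iota; lia.
move=> F0; exists (allpairs pair r r) => -[m n] /= mn.
apply: F0; apply: contraR mn; rewrite negb_or -!ltnNge => /andP[mM nM].
by apply/allpairsP; exists (m, n); rewrite !rP.
Qed.

Lemma fsum_int (F : int -> A) : fsupp F ->
  fsum F = fsum (fun n : nat => F n%:Z) + fsum (fun n : nat => F (- n.+1%:Z)).
Proof.
move=> /fsupp_vanish[M F0]; apply: fsum_split => //.
- by move=> i j; lia.
- by move=> i j; lia.
- by case=> n; [left; exists n | right; exists n; rewrite NegzE].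
- by apply: (@fsupp_nat M) => n Mn; apply: F0.
- by apply: (@fsupp_nat M) => n Mn; apply: F0; lia.
Qed.

Lemma fsum_shift (c : int) (F : int -> A) : fsum F = fsum (fun k => F (k + c)).
Proof.
by apply: fsum_reindex; exists (fun k => k - c) => k; rewrite ?addrK ?subrK.
Qed.

Lemma fsum_refl (c : int) (F : int -> A) : fsum F = fsum (fun k => F (c - k)).
Proof.
by apply: fsum_reindex; exists (fun k => c - k) => k; rewrite opprB addrCA subrr addr0.
Qed.

Lemma fsum_parity (F : int -> A) : fsupp F ->
  fsum F = fsum (fun k => F (2 * k)) + fsum (fun k => F (2 * k + 1)).
Proof.
move=> Ff; have [M F0] := fsupp_vanish Ff; apply: fsum_split => //.
- by move=> i j; lia.
- by move=> i j; lia.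
- by move=> i j; lia.
- move=> k; have [[m ->]|[m ->]] := int_parity k; first by left; exists m.
  by right; exists m.
- by apply: (@vanish_fsupp M) => k kM; apply: F0; lia.
- by apply: (@vanish_fsupp M.+1) => k kM; apply: F0; lia.
Qed.

(** The reflection k |-> 2 c + 1 - k has no fixed point, so the terms cancel in
pairs; no division by 2 is involved. *)
Lemma fsum_odd_refl (c : int) (F : int -> A) : fsupp F ->
  (forall k, F (2 * c + 1 - k) = - F k) -> fsum F = 0.
Proof.
move=> Ff Fs; rewrite (fsum_shift (c + 1)).
have Ff' : fsupp (fun k => F (k + (c + 1))).
  apply: (fsupp_reindex _ Ff).
  by exists (fun k => k - (c + 1)) => k; rewrite ?addrK ?subrK.
rewrite fsum_int // -[RHS](subrr (fsum (fun n : nat => F (n%:Z + (c + 1))))).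
congr (_ + _); rewrite -fsumN.
  apply: eq_fsum => n; rewrite -Fs; congr F; lia.
have [M F0] := fsupp_vanish Ff'.
by apply: (@fsupp_nat M) => n Mn; apply: F0.
Qed.

End FSum.

(** * Powers of a nilpotent element *)

Section Nilpotent.
Variables (A : comNzRingType) (K : nat) (q : A).
Hypothesis qK : q ^+ K = 0.

Lemma nil_exp m : (K <= m)%N -> q ^+ m = 0.
Proof. by move=> Km; rewrite -(subnK Km) exprD qK mulr0. Qed.

(** The inverse of 1 - q ^ v. *)
Definition ginv v : A := \sum_(i < K) q ^+ (v * i).

Lemma ginvP v : (0 < v)%N -> (1 - q ^+ v) * ginv v = 1.
Proof.
move=> v0; rewrite /ginv; under eq_bigr do rewrite exprM.
rewrite -[1 - _]opprB mulNr -subrX1 opprB -exprM nil_exp ?subr0 //.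
by rewrite leq_pmull.
Qed.

Lemma ginv_id v : (K <= v)%N -> ginv v = 1.
Proof.
case: v => [|v] Kv; last by have := @ginvP v.+1 isT; rewrite nil_exp // subr0 mul1r.
move: Kv qK; rewrite leqn0 => /eqP ->.
by rewrite expr0 => /eqP; rewrite oner_eq0.
Qed.

Definition qfac n : A := \prod_(i < n) (1 - q ^+ i.+1).
Definition iqfac n : A := \prod_(i < n) ginv i.+1.

Lemma qfacK n : qfac n * iqfac n = 1.
Proof. by rewrite -big_split big1 // => i _; rewrite /= ginvP. Qed.

Lemma iqfac0 : iqfac 0 = 1. Proof. exact: big_ord0. Qed.

(** Division-free form of 1/(q;q)_n = (1 - q^(n+1)) / (q;q)_(n+1): every identity
between the [iqfac] below is reduced with it to one in powers of q. *)
Lemma iqfacS n : iqfac n = (1 - q ^+ n.+1) * iqfac n.+1.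
Proof. by rewrite /iqfac big_ord_recr /= mulrCA ginvP ?mulr1. Qed.

Lemma iqfac_stable n : (K <= n)%N -> iqfac n = iqfac K.
Proof.
elim: n => [|n IHn]; first by rewrite leqn0 => /eqP ->.
rewrite leq_eqVlt => /predU1P[-> //|Kn].
by rewrite -IHn // /iqfac big_ord_recr /= ginv_id ?mulr1 // ltnW.
Qed.

Lemma unit_cancel (u v a b : A) : u * v = 1 -> u * a = u * b -> a = b.
Proof.
by move=> uv /(congr1 ( *%R v)); rewrite !mulrA [v * u]mulrC uv !mul1r.
Qed.

(** Integer exponents allow shifts and reflections of the summation index; the
value is meaningful for nonnegative exponents only. *)
Definition pw (e : int) : A := q ^+ `|e|%N.

Lemma pwD a b : 0 <= a -> 0 <= b -> pw (a + b) = pw a * pw b.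
Proof. by move=> a0 b0; rewrite /pw -exprD; congr (_ ^+ _); lia. Qed.

Lemma pw0 e : K%:Z <= e -> pw e = 0.
Proof. by move=> Ke; apply: nil_exp; lia. Qed.

Lemma pw_nat n : pw n%:Z = q ^+ n. Proof. by []. Qed.

(** (-1)^k for an integer k. *)
Definition sg (k : int) : A := (-1) ^+ `|k|%N.

Lemma sgD a b : sg (a + b) = sg a * sg b.
Proof.
rewrite /sg -exprD -signr_odd -[RHS]signr_odd; congr (_ ^+ nat_of_bool _); lia.
Qed.

Lemma sgN a : sg (- a) = sg a. Proof. by rewrite /sg abszN. Qed.
Lemma sg1 : sg 1 = -1. Proof. by []. Qed.
Lemma sg0 : sg 0 = 1. Proof. by []. Qed.
Lemma sgS a : sg (a + 1) = - sg a. Proof. by rewrite sgD mulrN1. Qed.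
Lemma sgB a b : sg (a - b) = sg a * sg b. Proof. by rewrite sgD sgN. Qed.
Lemma sgsg a : sg a * sg a = 1.
Proof. by rewrite -sgD /sg -signr_odd; rewrite (_ : odd _ = false) //; lia. Qed.
Lemma sg_nat n : sg n%:Z = (-1) ^+ n. Proof. by []. Qed.

(** The expansion of q^e / (1 - q^v) in nonnegative powers of q: for v < 0 it is
- q^(e-v) / (1 - q^(-v)). *)
Definition geo (e v : int) : A :=
  if 0 < v then pw e * ginv `|v|%N
  else if v < 0 then - (pw (e - v) * ginv `|v|%N) else 0.

Lemma geoK e v : v != 0 -> 0 <= e -> geo e v - geo (e + v) v = pw e.
Proof.
move=> v0 e0; rewrite /geo; case: ifP => vp.
  rewrite (pwD e0 (ltW vp)) -mulrA -mulrBr -{1}[ginv _]mul1r -mulrBl.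
  by rewrite {2}/pw ginvP ?mulr1 //; lia.
have vn : v < 0 by lia.
rewrite vn addrK opprK (_ : e - v = e + `|v|%N%:Z); last by lia.
rewrite pwD // addrC -mulrA -mulrBr -{1}[ginv _]mul1r -mulrBl.
by rewrite {2}/pw ginvP ?mulr1 //; lia.
Qed.

(** The lowest exponent in the expansion [geo e v] is nonnegative. *)
Definition geo_ok (e v : int) := if 0 < v then 0 <= e else 0 <= e - v.

Lemma geoM a e v : 0 <= a -> geo_ok e v -> pw a * geo e v = geo (a + e) v.
Proof.
rewrite /geo_ok /geo => a0; case: ifP => vp ok; first by rewrite (pwD a0 ok) mulrA.
case: ifP => vn; last by rewrite mulr0.
by rewrite -addrA (pwD a0 ok) mulrN mulrA.
Qed.

Lemma geo0 e v : (if 0 < v then K%:Z <= e else K%:Z <= e - v) -> geo e v = 0.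
Proof.
rewrite /geo; case: ifP => vp ok; first by rewrite pw0 // mul0r.
by case: ifP => vn //; rewrite pw0 // mul0r oppr0.
Qed.

(** Coefficient of w^n in Theta(w) = sum_n (-1)^n q^(n^2) w^n. *)
Definition theta (n : int) : A := sg n * pw (n * n).

Lemma theta0 n : (K <= `|n|)%N -> theta n = 0.
Proof. by move=> Kn; rewrite /theta pw0 ?mulr0 //; nia. Qed.

End Nilpotent.

(** * A Bailey pair, and sigma as a Hecke-type double sum *)

Fact tri_key : unit. Proof. by []. Qed.
(** Locked, so that unification does not unfold it inside exponents. *)
Definition tri n := locked_with tri_key (fun n => 'C(n.+1, 2)) n.
Lemma triE n : tri n = 'C(n.+1, 2). Proof. by rewrite /tri unlock. Qed.
Lemma triS n : tri n.+1 = (tri n + n.+1)%N.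
Proof. by rewrite !triE binS bin1 addnC. Qed.
Lemma tri0 : tri 0 = 0%N. Proof. by rewrite triE. Qed.
Lemma triSD n : (tri n + tri n.+1 = n.+1 * n.+1)%N.
Proof. by elim: n => [|n]; rewrite !triS ?tri0 //; nia. Qed.
Lemma triD m n : tri (m + n) = (tri m + m * n + tri n)%N.
Proof. by elim: n => [|n IHn]; rewrite ?addn0 ?muln0 ?tri0 ?addn0 // addnS !triS IHn;
  lia. Qed.
Lemma tri_ge n : (n <= tri n)%N.
Proof. by case: n => // n; rewrite triS leq_addl. Qed.

Section Bailey.
Variables (A : comNzRingType) (K : nat) (q : A).
Hypothesis qK : q ^+ K = 0.
Local Notation iq := (iqfac K q).

(** This is sum_(|r| <= n) (-1)^r q^(r(r-1)/2) / ((q;q)_(n-r) (q;q)_(n+r)) = 0 with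
the terms r and -r merged, a finite form of the vanishing of a theta function at
one of its zeros. *)
Lemma finite_theta n : (0 < n)%N ->
  iq n * iq n + \sum_(r < n) (-1) ^+ r.+1 * q ^+ tri r * (1 + q ^+ r.+1) *
    (iq (n - r.+1)%N * iq (n + r.+1)%N) = 0.
Proof.
move=> n0; have [m nE] : exists m, n = m.+1 by exists n.-1; rewrite prednK.
(* the partial sums have a closed form, which the last term cancels *)
pose F r := (-1) ^+ r.+1 * q ^+ tri r * (1 + q ^+ r.+1) *
  (iq (n - r.+1)%N * iq (n + r.+1)%N).
have part s : (s <= m)%N -> (1 - q ^+ n) * (iq n * iq n + \sum_(r < s) F r) =
    (-1) ^+ s * q ^+ tri s * (iq (m - s)%N * iq (n + s)%N).
  elim: s => [_|s IHs sm].
    by rewrite big_ord0 addr0 subn0 addn0 (iqfacS qK m) -nE tri0; ring.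
  rewrite big_ord_recr /= addrA mulrDr IHs; last exact: ltnW.
  rewrite /F; have -> : (n - s.+1 = m - s)%N by rewrite nE.
  have -> : (m - s = (m - s.+1).+1)%N by lia.
  rewrite (iqfacS qK (n + s)) (iqfacS qK (m - s.+1)) triS exprD !addnS !exprS.
  have -> : q ^+ n = q * q ^+ s * q ^+ (m - s.+1).+1.
    by rewrite -exprS -exprD; congr (_ ^+ _); lia.
  have -> : q ^+ (n + s) = q * q ^+ s * q ^+ (m - s.+1).+1 * q ^+ s.
    by rewrite -exprS -!exprD; congr (_ ^+ _); lia.
  by rewrite !exprS; ring.
have Fn : \sum_(r < n) F r = \sum_(r < m) F r + F m by rewrite [in LHS]nE big_ord_recr.
apply: (unit_cancel (ginvP qK n0)); rewrite mulr0.
rewrite -[\sum_(r < n) _]/(\sum_(r < n) F r) Fn addrA mulrDr part // /F -nE !subnn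
  (iqfacS qK (n + m)).
have -> : q ^+ (n + m).+1 = q ^+ n * q ^+ n by rewrite -exprD; congr (_ ^+ _); lia.
have -> : (-1) ^+ n = - (-1) ^+ m :> A by rewrite nE exprS mulN1r.
have -> : (n + n = (n + m).+1)%N by lia.
by ring.
Qed.

(** q^(r(r-1)/2) times the sum of q^(-j(j+1)/2) over j < r, j >= 0, written with
nonnegative exponents. *)
Definition hecke_row r : A := \sum_(m < r) q ^+ ((2 * m + 1) * (r.-1 - m)).

Lemma hecke_row0 : hecke_row 0 = 0. Proof. exact: big_ord0. Qed.
Lemma hecke_row1 : hecke_row 1 = 1. Proof. by rewrite /hecke_row big_ord1 /=. Qed.
Lemma hecke_rowSS r : hecke_row r.+2 = q ^+ (2 * r + 1) * hecke_row r + 1 + q ^+ r.+1.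
Proof.
rewrite /hecke_row big_ord_recr /= subnn muln0 expr0 big_ord_recl /= mulr_sumr.
have -> : ((2 * 0 + 1) * (r.+1 - 0) = r.+1)%N by lia.
rewrite [X in _ + X + 1](eq_bigr (fun m : 'I_r =>
    q ^+ (2 * r + 1) * q ^+ ((2 * m + 1) * (r.-1 - m)))); last first.
  move=> m _; rewrite -exprD; congr (_ ^+ _).
  by have := ltn_ord m; rewrite /bump /=; case: r m => [[]//|r m]; nia.
by rewrite -addrA addrC.
Qed.

(** Numerator of the Bailey pair: up to a power of q, the sum of q^(-j(j+1)/2) over
all j between -r and r. *)
Definition hecke_row_pair r : A := q ^+ r * hecke_row r + hecke_row r.+1.

Lemma hecke_row_pairS r : hecke_row_pair r.+1 - q ^+ r.+1 * hecke_row_pair r =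
  1 + q ^+ r.+1.
Proof.
rewrite /hecke_row_pair hecke_rowSS mulrDr [q ^+ r.+1 * (q ^+ r * _)]mulrA -exprD.
have -> : (r.+1 + r = 2 * r + 1)%N by lia.
by ring.
Qed.

(** Right-hand side of a Bailey pair relative to a = q. *)
Definition bailey_sum n : A := \sum_(r < n.+1)
  (-1) ^+ r * q ^+ tri r * hecke_row_pair r * (iq (n - r)%N * iq (n + r.+1)%N).

(** Write (1 - q^(N-r)) (1 - q^(N+r+1)) as 1 - q^(2N+1) minus a remainder; after
summation by parts the remainder becomes [finite_theta]. *)
Lemma bailey_sumS n : bailey_sum n = (1 - q ^+ (2 * n.+1 + 1)) * bailey_sum n.+1.
Proof.
set N := n.+1.
pose B r := iq (N - r)%N * iq (N + r)%N.
pose c r : A := (-1) ^+ r * q ^+ tri r * hecke_row_pair r.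
have E1 : bailey_sum n = \sum_(r < N.+1) c r *
    ((1 - q ^+ (N - r)) * (1 - q ^+ (N + r.+1)) * (iq (N - r)%N * iq (N + r.+1)%N)).
  rewrite [RHS]big_ord_recr /= subnn expr0 subrr mul0r mul0r mulr0 addr0.
  apply: eq_bigr => r _; rewrite /c; congr (_ * _).
  have -> : (N - r = (n - r).+1)%N by have := ltn_ord r; lia.
  by rewrite (iqfacS qK (n - r)) (iqfacS qK (n + r.+1)) -addSn; ring.
have E2 : (1 - q ^+ (2 * N + 1)) * bailey_sum N = \sum_(r < N.+1) c r *
    ((1 - q ^+ (N - r)) * (1 - q ^+ (N + r.+1)) * (iq (N - r)%N * iq (N + r.+1)%N))
  + (\sum_(r < N.+1) c r * q ^+ (N - r) * B r
     + \sum_(r < N.+1) c r * (q ^+ (N - r) * q ^+ (2 * r + 1) * (1 - q ^+ (N - r)) *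
         (iq (N - r)%N * iq (N + r.+1)%N))).
  rewrite -!big_split mulr_sumr; apply: eq_bigr => r _ /=; rewrite /c /B.
  have rN : (r <= N)%N by rewrite -ltnS ltn_ord.
  have -> : q ^+ (2 * N + 1) = q ^+ (N - r) * q ^+ (N + r.+1).
    by rewrite -exprD; congr (_ ^+ _); lia.
  rewrite (iqfacS qK (N + r)) -addnS.
  have -> : q ^+ (N + r.+1) = q ^+ (N - r) * q ^+ (2 * r + 1).
    by rewrite -exprD; congr (_ ^+ _); lia.
  by ring.
rewrite E2 E1 -[LHS]addr0; congr (_ + _); apply/esym.
rewrite big_ord_recl [X in _ + X]big_ord_recr /= subnn subrr mulr0 mul0r mulr0 addr0.
rewrite -addrA -big_split /=.
have := congr1 ( *%R (q ^+ N)) (@finite_theta N isT); rewrite mulr0; apply: etrans.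
rewrite mulrDr mulr_sumr.
congr (_ + _).
  by rewrite /c /B /hecke_row_pair hecke_row0 hecke_row1 subn0 addn0 tri0; ring.
apply: eq_bigr => r _; rewrite /bump /= add1n -hecke_row_pairS /c /B.
have rn := ltn_ord r.
have -> : (N - r = (N - r.+1).+1)%N by lia.
rewrite (iqfacS qK (N - r.+1)) triS.
have -> : q ^+ N = q ^+ r.+1 * q ^+ (N - r.+1) by rewrite -exprD; congr (_ ^+ _); lia.
have -> : (2 * r + 1 = r + r.+1)%N by lia.
by rewrite !exprS !exprD !exprS; ring.
Qed.

Definition oddfac n : A := \prod_(k < n) (1 - q ^+ (2 * k + 1)).

(** Hence the left member of the Bailey pair is 1/(q;q^2)_(n+1). *)
Lemma bailey_sumP n : oddfac n.+1 * bailey_sum n = 1.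
Proof.
elim: n => [|n IHn]; last first.
  by rewrite -[RHS]IHn [in RHS]bailey_sumS /oddfac [in LHS]big_ord_recr /= mulrA.
rewrite /oddfac /bailey_sum !big_ord1 /= /hecke_row_pair hecke_row0 hecke_row1 tri0
  mulr0 add0r !expr0 !mul1r.
by rewrite mulrCA -(iqfacS qK 0) iqfac0 mulr1.
Qed.

(** Collecting the coefficient of each [hecke_row] makes the pair relative to a = 1,
with the factor 1 - q^(2r) that the conjugate pair turns into 1 - q^r. *)
Lemma bailey_sum_regroup n : bailey_sum n = \sum_(r < n.+1)
  (-1) ^+ r * q ^+ tri r * (1 - q ^+ (2 * r.+1)) * hecke_row r.+1 *
    (iq (n - r)%N * iq (n + r.+2)%N).
Proof.
pose T r := iq (n - r)%N * iq (n + r.+1)%N.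
have -> : bailey_sum n = \sum_(r < n.+1) (-1) ^+ r * q ^+ (tri r +
  r) * hecke_row r * T r
    + \sum_(r < n.+1) (-1) ^+ r * q ^+ tri r * hecke_row r.+1 * T r.
  by rewrite -big_split; apply: eq_bigr => r _; rewrite /T /hecke_row_pair exprD /=;
    ring.
rewrite big_ord_recl hecke_row0 mulr0 mul0r add0r big_ord_recr [RHS]big_ord_recr /=
  addrA.
rewrite -big_split; congr (_ + _); last first.
  rewrite /T subnn (iqfacS qK (n + n.+1)) -addnS; have ->
    : (n + n.+2 = 2 * n.+1)%N by lia.
  by ring.
apply: eq_bigr => r _; rewrite /bump /= add1n /T.
have rn := ltn_ord r.
have -> : (n - r = (n - r.+1).+1)%N by lia.
rewrite (iqfacS qK (n - r.+1)) (iqfacS qK (n + r.+1)) -addnS triS.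
have -> : q ^+ (n + r.+2) = q ^+ (2 * r.+1) * q ^+ (n - r.+1).+1.
  by rewrite -exprD; congr (_ ^+ _); lia.
have -> : (tri r + r.+1 + r.+1 = tri r + 2 * r.+1)%N by lia.
by rewrite !exprD ![(-1) ^+ r.+1]exprS; ring.
Qed.

Definition qfac_opp n : A := \prod_(k < n) (1 + q ^+ k.+1).

Lemma qfac_oppS n : qfac_opp n.+1 = qfac_opp n * (1 + q ^+ n.+1).
Proof. exact: big_ord_recr. Qed.

Lemma qfac_opp_stable n : (K <= n)%N -> qfac_opp n = qfac_opp K.
Proof.
elim: n => [|n IHn]; first by rewrite leqn0 => /eqP ->.
rewrite leq_eqVlt => /predU1P[-> //|Kn].
by rewrite qfac_oppS (nil_exp qK (ltnW Kn)) addr0 mulr1 IHn.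
Qed.

Definition qfac_opp_tail r i : A := \prod_(k < i) (1 + q ^+ (r + k.+1)).

Lemma qfac_oppD r i : qfac_opp (r + i) = qfac_opp r * qfac_opp_tail r i.
Proof.
elim: i => [|i IHi]; first by rewrite addn0 /qfac_opp_tail big_ord0 mulr1.
by rewrite addnS qfac_oppS IHi /qfac_opp_tail big_ord_recr mulrA addnS.
Qed.

(** A limiting case of the q-Gauss sum, with the denominator parameter q^(2r+3)
replaced by q^(2r+3+j). *)
Definition gauss_sum r j : A := \sum_(i < K.+1)
  qfac_opp_tail r i * q ^+ ((r.+2 + j) * i + 'C(i, 2)) * iq i * iq (2 * r.+1 + j + i)%N.

(** The difference of the two sides telescopes, so the sum is evaluated by letting j
tend to infinity. *)
Lemma gauss_sumS r j : gauss_sum r j = (1 + q ^+ (r.+2 + j)) * gauss_sum r j.+1.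
Proof.
pose x := q ^+ (r.+2 + j).
pose u i := qfac_opp_tail r i * q ^+ ((r.+2 + j) * i + 'C(i, 2)) * iq i *
  iq (2 * r.+1 + j + i).+1.
pose d i := u i * (1 - q ^+ i) * (1 - q ^+ (2 * r.+1 + j + i).+1).
have dS i : d i.+1 = u i * x * q ^+ i * (1 + q ^+ (r + i.+1)).
  rewrite /d /u /x /qfac_opp_tail big_ord_recr /= (iqfacS qK i).
  have -> : (2 * r.+1 + j + i.+1 = (2 * r.+1 + j + i).+1)%N by lia.
  rewrite (iqfacS qK (2 * r.+1 + j + i).+1) binS bin1.
  have -> : ((r.+2 + j) * i.+1 + ('C(i, 2) + i) =
     (r.+2 + j) * i + 'C(i, 2) + (r.+2 + j) + i)%N by rewrite mulnS; lia.
  by rewrite !exprD; ring.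
apply/eqP; rewrite -subr_eq0; apply/eqP.
transitivity (\sum_(i < K.+1) (d i - d i.+1)).
  rewrite /gauss_sum mulr_sumr -sumrB; apply: eq_bigr => i _.
  rewrite dS /d (iqfacS qK (2 * r.+1 + j + i)).
  have -> : (2 * r.+1 + j.+1 + i = (2 * r.+1 + j + i).+1)%N by lia.
  have -> : ((r.+2 + j.+1) * i + 'C(i, 2) = (r.+2 + j) * i + 'C(i, 2) + i)%N by lia.
  rewrite [q ^+ (_ + i)]exprD -/x.
  have -> : q ^+ (2 * r.+1 + j + i).+1 = x * q ^+ (r + i.+1).
    by rewrite /x -exprD; congr (_ ^+ _); lia.
  have -> : q ^+ (r + i.+1) = q ^+ r.+1 * q ^+ i.
    by rewrite -exprD; congr (_ ^+ _); lia.
  rewrite /u -/x.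
  move: (qfac_opp_tail r i) (q ^+ (_ + 'C(i, 2))) (iq i) (iq _) (q ^+ i) (q ^+ r.+1).
  by move=> a b c e y z; clearbody x; ring.
rewrite -(big_mkord xpredT (fun i => d i - d i.+1)).
rewrite -[LHS]opprK -sumrN; under eq_bigr do rewrite opprB.
rewrite telescope_sumr // /d /u expr0 subrr mulr0 mul0r subr0.
by rewrite (@nil_exp _ _ _ qK (_ + _)%N) ?mulr0 ?mul0r ?oppr0 //; nia.
Qed.

Lemma gauss_sum_stable r j : (K <= j)%N -> gauss_sum r j = iq K.
Proof.
move=> Kj; rewrite /gauss_sum big_ord_recl /= big1 ?addr0 => [|i _].
  rewrite /qfac_opp_tail big_ord0 muln0 mul1r iqfac0 mulr1 mul1r.
  by rewrite (iqfac_stable qK) //; lia.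
by rewrite (@nil_exp _ _ _ qK (_ + _)%N) ?mulr0 ?mul0r // /bump; nia.
Qed.

Lemma gauss_sumP r : (1 + q ^+ r.+1) * qfac_opp r * gauss_sum r 0 = qfac_opp K * iq K.
Proof.
have gE n : gauss_sum r 0 = (\prod_(j < n) (1 + q ^+ (r.+2 + j))) * gauss_sum r n.
  elim: n => [|n IHn]; first by rewrite big_ord0 mul1r.
  by rewrite big_ord_recr /= -mulrA -gauss_sumS.
rewrite (gE K) gauss_sum_stable // mulrA; congr (_ * _).
rewrite -(@qfac_opp_stable (r.+1 + K)) ?leq_addl // qfac_oppD qfac_oppS.
rewrite [_ * qfac_opp r]mulrC; congr (_ * _).
by apply: eq_bigr => j _; rewrite addnS.
Qed.

(** The conjugate Bailey pair that carries sigma: it produces the prefactor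
(-q;q) / (q;q), independent of r. *)
Lemma conjugate_pair r : fsum (fun n => if (r <= n)%N then
    qfac_opp n * q ^+ tri n.+1 * (1 - q ^+ (2 * r.+1)) *
      (iq (n - r)%N * iq (n + r.+2)%N) else 0) =
  q ^+ tri r.+1 * (1 - q ^+ r.+1) * (qfac_opp K * iq K).
Proof.
pose F i := qfac_opp (r + i) * q ^+ tri (r + i).+1 * (1 - q ^+ (2 * r.+1)) *
  (iq i * iq (r + i + r.+2)%N).
rewrite -[RHS](_ : fsum F = _).
  rewrite -(fsum_nat_shift r F); apply: eq_fsum => n; case: ifP => // rn.
  by rewrite /F !subnKC.
rewrite (@fsum_nat _ K.+1) => [|i Ki]; last first.
  by rewrite /F (@nil_exp _ _ _ qK (tri _)) ?mulr0 ?mul0r // (leq_trans _ (tri_ge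
    _)) //; lia.
rewrite -(gauss_sumP r) /gauss_sum !mulr_sumr; apply: eq_bigr => i _.
rewrite /F qfac_oppD -addSn triD addn0.
have -> : (tri i = 'C(i, 2) + i)%N by rewrite triE binS bin1.
have -> : (r + i + r.+2 = 2 * r.+1 + i)%N by lia.
have -> : (2 * r.+1 + 0 + i = 2 * r.+1 + i)%N by lia.
have -> : (tri r.+1 + r.+1 * i + ('C(i, 2) + i) = tri r.+1 + (r.+2 * i +
  'C(i, 2)))%N by lia.
have -> : (2 * r.+1 = r.+1 + r.+1)%N by lia.
by rewrite !exprD; ring.
Qed.

(** sigma(q) at a nilpotent q, with 1/(q;q^2)_(n+1) in its Bailey form. *)
Definition sigma_at : A := fsum (fun n => q ^+ tri n.+1 * qfac_opp n * bailey_sum n).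

Definition hecke_sum : A := fsum (fun r =>
  (-1) ^+ r * q ^+ (r.+1 * r.+1) * (1 - q ^+ r.+1) * hecke_row r.+1).

Lemma sigma_hecke : sigma_at = qfac_opp K * iq K * hecke_sum.
Proof.
pose H r n := (-1) ^+ r * q ^+ tri r * hecke_row r.+1 *
  if (r <= n)%N then qfac_opp n * q ^+ tri n.+1 * (1 - q ^+ (2 * r.+1)) *
      (iq (n - r)%N * iq (n + r.+2)%N) else 0.
have Hf : fsupp (fun x : nat * nat => H x.1 x.2).
  apply: (@fsupp_nat2 _ K) => r n rn; rewrite /H; case: ifP => rn';
    last by rewrite mulr0.
  rewrite (@nil_exp _ _ _ qK (tri n.+1)) ?mulr0 ?mul0r ?mulr0 //.
  by rewrite (leq_trans _ (tri_ge _)) //; lia.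
transitivity (fsum (fun n => fsum (H^~ n))).
  apply: eq_fsum => n; rewrite bailey_sum_regroup (@fsum_nat _ n.+1) => [|r nr];
    last first.
    by rewrite /H leqNgt nr mulr0.
  rewrite mulr_sumr; apply: eq_bigr => r _.
  by rewrite /H -ltnS ltn_ord; ring.
rewrite -(fsum_exchange Hf) /hecke_sum fsumMl; last first.
  apply: (@fsupp_nat _ K) => r Kr.
  by rewrite (@nil_exp _ _ _ qK (_ * _)%N) ?mulr0 ?mul0r //; nia.
apply: eq_fsum => r; rewrite /H -fsumMl ?conjugate_pair; last first.
  apply: (@fsupp_nat _ K) => n Kn; case: ifP => // _.
  rewrite (@nil_exp _ _ _ qK (tri n.+1)) ?mulr0 ?mul0r //.
  by rewrite (leq_trans _ (tri_ge _)) //; lia.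
by rewrite -triSD !exprD; ring.
Qed.

End Bailey.

(** * The Jacobi triple product *)

Section Products.
Variables (A : comNzRingType) (K : nat) (q : A).
Hypothesis qK : q ^+ K = 0.

(** The infinite product (q^a; q^b), whose factors of index at least K are 1. *)
Definition qprod a b : A := \prod_(i < K) (1 - q ^+ (b * i + a)).

Lemma qprod_stable a b n : (0 < b)%N -> (K <= n)%N ->
  \prod_(i < n) (1 - q ^+ (b * i + a)) = qprod a b.
Proof.
move=> b0; elim: n => [|n IHn]; first by rewrite leqn0 /qprod => /eqP ->.
rewrite leq_eqVlt => /predU1P[<- //|Kn].
rewrite big_ord_recr /= (nil_exp qK) ?subr0 ?mulr1 ?IHn //; nia.
Qed.

Lemma big_ord_mul (F : nat -> A) n m :
  \prod_(i < n * m) F i = \prod_(i < n) \prod_(c < m) F (i * m + c)%N.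
Proof.
elim: n => [|n IHn]; first by rewrite !big_ord0.
by rewrite mulSnr big_split_ord /= IHn big_ord_recr.
Qed.

Lemma qprod_split m a b : (0 < b)%N -> (0 < m)%N ->
  qprod a b = \prod_(c < m) qprod (b * c + a) (b * m).
Proof.
move=> b0 m0; rewrite -(@qprod_stable a b (K * m)) //; last by rewrite leq_pmulr.
rewrite (big_ord_mul (fun i => 1 - q ^+ (b * i + a))) exchange_big /=.
apply: eq_bigr => c _; apply: eq_bigr => i _; congr (1 - q ^+ _); lia.
Qed.

Lemma qprod_unit a b : (0 < a)%N -> exists v, qprod a b * v = 1.
Proof.
move=> a0; exists (\prod_(i < K) ginv K q (b * i + a)).
by rewrite -big_split big1 // => i _; rewrite /= ginvP // addn_gt0 a0 orbT.
Qed.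

End Products.

Section JacobiTriple.
Variables (A : comNzRingType) (K : nat) (q : A).
Hypothesis qK : q ^+ K = 0.
Variables (c d : nat).
Hypothesis dc : (d < c)%N.
Let Q := q ^+ (2 * c).
Let QK : Q ^+ K = 0.
Proof. by rewrite /Q -exprM mulnC exprM qK expr0n; case: (c) dc. Qed.
Local Notation pw := (pw q).

(** 1/(Q;Q)_k, extended by 0 to k < 0 so that finite sums run over all of int. *)
Definition iqfacz (k : int) : A := if k is Posz n then iqfac K Q n else 0.

Lemma iqfaczS k : iqfacz (k - 1) = (1 - pw (2 * c%:Z * k)) * iqfacz k.
Proof.
case: k => [[|n]|n].
- by rewrite mulr0 /pw expr0 subrr mul0r.
- have -> : n.+1%:Z - 1 = n%:Z by lia.
  rewrite /= (iqfacS QK) /Q -exprM; congr ((1 - q ^+ _) * _); lia.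
- have -> : Negz n - 1 = Negz n.+1 by lia.
  by rewrite mulr0.
Qed.

Lemma jacobi_exp_ge (j : int) : `|j|%N%:Z <= c%:Z * j * j + d%:Z * j.
Proof.
have [j0|j0] := leP 0 j; first by nia.
have -> : j = - (`|j|%N%:Z) by lia.
move: `|j|%N => m; rewrite abszN absz_nat; case: m => [|m]; first by lia.
have H : m.+1%:Z * 1 <= m.+1%:Z * (c%:Z * m.+1%:Z - d%:Z).
  by rewrite ler_pM2l //; nia.
by lia.
Qed.

Lemma jacobi_exp_ge0 (j : int) : 0 <= c%:Z * j * j + d%:Z * j.
Proof. exact: le_trans (jacobi_exp_ge j). Qed.

Definition jacobi_term (j : int) : A := sg A j * pw (c%:Z * j * j + d%:Z * j).

Lemma jacobi_term0 j : (K <= `|j|)%N -> jacobi_term j = 0.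
Proof. by move=> Kj; rewrite /jacobi_term (pw0 qK) ?mulr0 //; have := jacobi_exp_ge j;
  lia. Qed.

Definition jacobi_fin n : A := fsum (fun j => jacobi_term j * (iqfacz (n%:Z -
  j) * iqfacz (n%:Z + j))).

Lemma iqfacz_fsupp (G : int -> A) (n m : int) :
  fsupp (fun j => G j * (iqfacz (n - j) * iqfacz (m + j))).
Proof.
apply: (@vanish_fsupp _ (`|n| + `|m|).+1) => j jM.
have [H|H] : (n - j < 0) \/ (m + j < 0) by lia.
  by case: (n - j) H => // k _; rewrite /= mul0r mulr0.
by case: (m + j) H => // k _; rewrite /= mulr0 mulr0.
Qed.

(** Multiplying by the two new factors shifts the summation index by one in either
direction; the coefficient of each term is then a polynomial identity in Q^(n-j),
Q^(n+j) and Q. *)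
Lemma jacobi_finS n : (1 - Q ^+ (2 * n + 2)) * (1 - Q ^+ (2 * n +
  1)) * jacobi_fin n.+1 =
  (1 - q ^+ (2 * c * n + (c + d))) * (1 - q ^+ (2 * c * n + (c - d))) * jacobi_fin n.
Proof.
pose N : int := n%:Z + 1.
pose b j := iqfacz (N - j) * iqfacz (N + j).
pose a1 j := pw (2 * c%:Z * (N - j)).
pose b1 j := pw (2 * c%:Z * (N + j)).
pose a2 j := pw (2 * c%:Z * (n%:Z - j)).
pose b2 j := pw (2 * c%:Z * (n%:Z + j)).
have sb (G : int -> A) : fsupp (fun j => G j * b j) by exact: iqfacz_fsupp.
have E0 : jacobi_fin n = fsum (fun j => jacobi_term j * (1 - a1 j) * (1 - b1 j) * b j).
  apply: eq_fsum => j; rewrite /b /a1 /b1.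
  have -> : n%:Z - j = N - j - 1 by rewrite /N; lia.
  have -> : n%:Z + j = N + j - 1 by rewrite /N; lia.
  by rewrite !iqfaczS; ring.
(* the middle factors move the summation index by one step *)
have E1 : q ^+ (2 * c * n + (c + d)) * jacobi_fin n =
    fsum (fun j => - (jacobi_term j * a1 j * (1 - b2 j) * (1 - b1 j)) * b j).
  rewrite /jacobi_fin fsumMl; last exact: iqfacz_fsupp.
  rewrite (fsum_shift (-1)); apply: eq_fsum => j.
  have -> : n%:Z + (j - 1) = N + j - 1 - 1 by rewrite /N; lia.
  have -> : n%:Z - (j - 1) = N - j by rewrite /N; lia.
  rewrite /b !iqfaczS (_ : N + j - 1 = n%:Z + j); last by rewrite /N; lia.
  rewrite -/(b2 j) -/(b1 j); case: (lerP 0 (N - j)) => [H|]; last first.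
    by case: (N - j) => // k _; rewrite /= !(mul0r, mulr0).
  suff E : q ^+ (2 * c * n + (c + d)) * jacobi_term (j - 1) = - (jacobi_term j * a1 j).
    by rewrite mulrA E; ring.
  have E : q ^+ (2 * c * n + (c + d)) * pw (c%:Z * (j - 1) * (j - 1) + d%:Z * (j - 1))
      = pw (c%:Z * j * j + d%:Z * j) * a1 j.
    by rewrite /a1 -(pw_nat q) -!pwD; [congr pw; rewrite /N;
      lia|exact: jacobi_exp_ge0|by rewrite mulr_ge0|by []|exact: jacobi_exp_ge0].
  rewrite /jacobi_term sgB sg1; transitivity (- sg A j * (pw (c%:Z * j * j +
    d%:Z * j) * a1 j)).
    by rewrite -E; ring.
  by ring.
have E2 : q ^+ (2 * c * n + (c - d)) * jacobi_fin n =
    fsum (fun j => - (jacobi_term j * b1 j * (1 - a2 j) * (1 - a1 j)) * b j).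
  rewrite /jacobi_fin fsumMl; last exact: iqfacz_fsupp.
  rewrite (fsum_shift 1); apply: eq_fsum => j.
  have -> : n%:Z - (j + 1) = N - j - 1 - 1 by rewrite /N; lia.
  have -> : n%:Z + (j + 1) = N + j by rewrite /N; lia.
  rewrite /b !iqfaczS (_ : N - j - 1 = n%:Z - j); last by rewrite /N; lia.
  rewrite -/(a2 j) -/(a1 j); case: (lerP 0 (N + j)) => [H|]; last first.
    by case: (N + j) => // k _; rewrite /= !(mul0r, mulr0).
  suff E : q ^+ (2 * c * n + (c - d)) * jacobi_term (j + 1) = - (jacobi_term j * b1 j).
    by rewrite mulrA E; ring.
  have E : q ^+ (2 * c * n + (c - d)) * pw (c%:Z * (j + 1) * (j + 1) + d%:Z * (j + 1))
      = pw (c%:Z * j * j + d%:Z * j) * b1 j.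
    by rewrite /b1 -(pw_nat q) -!pwD; [congr pw; rewrite /N;
      lia|exact: jacobi_exp_ge0|by rewrite mulr_ge0|by []|exact: jacobi_exp_ge0].
  rewrite /jacobi_term sgS; transitivity (- sg A j * (pw (c%:Z * j * j +
    d%:Z * j) * b1 j)).
    by rewrite -E; ring.
  by ring.
have -> : (1 - q ^+ (2 * c * n + (c + d))) * (1 - q ^+ (2 * c * n +
  (c - d))) * jacobi_fin n
   = (1 + Q ^+ (2 * n + 1)) * jacobi_fin n
     - q ^+ (2 * c * n + (c + d)) * jacobi_fin n - q ^+ (2 * c * n +
       (c - d)) * jacobi_fin n.
  have -> : Q ^+ (2 * n + 1) = q ^+ (2 * c * n + (c + d)) * q ^+ (2 * c * n + (c - d)).
    by rewrite /Q -exprM -exprD; congr (_ ^+ _); lia.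
  by ring.
rewrite E1 E2 E0 fsumMl; last exact: sb.
rewrite -fsumB; [|exact/fsuppM/sb|exact: sb].
rewrite -fsumB; [|apply: fsuppB; [exact/fsuppM/sb|exact: sb]|exact: sb].
rewrite /jacobi_fin fsumMl; last exact: iqfacz_fsupp.
apply: eq_fsum => j.
have -> : iqfacz (n.+1%:Z - j) * iqfacz (n.+1%:Z + j) = b j.
  by rewrite /b /N; congr (iqfacz _ * iqfacz _); lia.
suff [b0|E] : b j = 0 \/ (1 - Q ^+ (2 * n + 2)) * (1 - Q ^+ (2 * n + 1)) =
    (1 + Q ^+ (2 * n + 1)) * (1 - a1 j) * (1 - b1 j) +
    a1 j * (1 - b2 j) * (1 - b1 j) + b1 j * (1 - a2 j) * (1 - a1 j).
- by rewrite b0 !mulr0 subr0 subr0.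
- by rewrite E; ring.
have Qp m : Q ^+ m = pw (2 * c%:Z * m%:Z) by rewrite /Q -exprM /pw; congr (_ ^+ _); lia.
have [->|j1] := eqVneq j N.
  have -> : a1 N = 1 by rewrite /a1 subrr mulr0 /pw expr0.
  have -> : b1 N = Q ^+ (2 * n + 2) by rewrite Qp /b1 /N; congr pw; lia.
  have -> : b2 N = Q ^+ (2 * n + 1) by rewrite Qp /b2 /N; congr pw; lia.
  by right; ring.
have [->|j2] := eqVneq j (- N).
  have -> : b1 (- N) = 1 by rewrite /b1 subrr mulr0 /pw expr0.
  have -> : a1 (- N) = Q ^+ (2 * n + 2) by rewrite Qp /a1 /N; congr pw; lia.
  have -> : a2 (- N) = Q ^+ (2 * n + 1) by rewrite Qp /a2 /N; congr pw; lia.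
  by right; ring.
have [jn|jn] := leqP `|j|%N n.
  right; have na : 0 <= 2 * c%:Z * (n%:Z - j) by rewrite mulr_ge0 //; lia.
  have nb : 0 <= 2 * c%:Z * (n%:Z + j) by rewrite mulr_ge0 //; lia.
  have nc : 0 <= 2 * c%:Z by [].
  have QE : Q = pw (2 * c%:Z) by rewrite /Q /pw; congr (_ ^+ _); lia.
  have -> : a1 j = a2 j * Q by rewrite QE -pwD // /a1 /N; congr pw; lia.
  have -> : b1 j = b2 j * Q by rewrite QE -pwD // /b1 /N; congr pw; lia.
  have E1' : Q ^+ (2 * n + 1) = a2 j * b2 j * Q.
    by rewrite Qp QE -!pwD ?addr_ge0 //; congr pw; lia.
  have -> : Q ^+ (2 * n + 2) = a2 j * b2 j * Q * Q.
    by rewrite -E1' -exprSr; congr (_ ^+ _); lia.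
  by rewrite E1'; move: (a2 j) (b2 j); clearbody Q => x y; ring.
left; rewrite /b.
have [H|H] : (N - j < 0) \/ (N + j < 0) by rewrite /N; move: j1 j2; rewrite /N; lia.
  by case: (N - j) H => // k _; rewrite /= mul0r.
by case: (N + j) H => // k _; rewrite /= mulr0.
Qed.

Lemma jacobi_fin0 : jacobi_fin 0 = 1.
Proof.
rewrite /jacobi_fin (@fsumE _ _ [:: 0 : int]) ?big_seq1 //; last first.
  move=> j; rewrite inE => j0.
  have [H|H] : (0 - j < 0) \/ (0 + j < 0) by move: j0; lia.
    by case: (0 - j) H => // k _; rewrite /= mul0r mulr0.
  by case: (0 + j) H => // k _; rewrite /= !mulr0.
by rewrite /jacobi_term /iqfacz /= !mulr0 addr0 /pw expr0 sg0 iqfac0 !mulr1.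
Qed.

Lemma jacobi_finP n : qfac Q (2 * n) * jacobi_fin n =
  \prod_(i < n) ((1 - q ^+ (2 * c * i + (c + d))) * (1 - q ^+ (2 * c * i + (c - d)))).
Proof.
elim: n => [|n IHn]; first by rewrite muln0 /qfac !big_ord0 jacobi_fin0 mulr1.
rewrite big_ord_recr -IHn /=.
have -> : (2 * n.+1 = (2 * n).+2)%N by lia.
rewrite /qfac !big_ord_recr /=; have := jacobi_finS n.
have -> : (2 * n + 2 = (2 * n).+2)%N by lia.
have -> : (2 * n + 1 = (2 * n).+1)%N by lia.
set P := \prod_(i < 2 * n) _; clearbody P => E.
transitivity (P * ((1 - Q ^+ (2 * n).+2) * (1 - Q ^+ (2 * n).+1) * jacobi_fin n.+1)).
  by ring.
by rewrite E; ring.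
Qed.

(** sum_j (-1)^j q^(c j^2 + d j), as the limit of [jacobi_finP]. *)
Lemma jacobi_triple : fsum jacobi_term =
  qprod K q (2 * c) (2 * c) * qprod K q (c + d) (2 * c) * qprod K q (c - d) (2 * c).
Proof.
have c0 : (0 < 2 * c)%N by lia.
have QP n : qfac Q n = \prod_(i < n) (1 - q ^+ (2 * c * i + 2 * c)).
  by apply: eq_bigr => i _; rewrite /Q -exprM; congr (1 - _ ^+ _); lia.
(* only terms with |j| < K survive, and there 2 K - j and 2 K + j exceed K *)
have jf : jacobi_fin (2 * K) = iqfac K Q K * iqfac K Q K * fsum jacobi_term.
  rewrite fsumMl; last by apply: (@vanish_fsupp _ K) => j; exact: jacobi_term0.
  apply: eq_fsum => j; have [jK|jK] := ltnP `|j|%N K; last first.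
    by rewrite jacobi_term0 // mulr0 mul0r.
  rewrite mulrC; congr (_ * _).
  have -> : (2 * K)%:Z - j = (absz ((2 * K)%:Z - j))%:Z by lia.
  have -> : (2 * K)%:Z + j = (absz ((2 * K)%:Z + j))%:Z by lia.
  by rewrite /= !(iqfac_stable QK) //; lia.
have := jacobi_finP (2 * K); rewrite jf big_split /= !(qprod_stable qK) //; try by lia.
have -> : qfac Q (2 * (2 * K)) = qprod K q (2 * c) (2 * c).
  by rewrite QP (qprod_stable qK) //; lia.
have e1 : qprod K q (2 * c) (2 * c) * iqfac K Q K = 1
  by rewrite /qprod -(QP K) (qfacK QK).
rewrite !mulrA e1 mul1r => e2.
by rewrite -mulrA -e2 mulrA e1 mul1r.
Qed.



End JacobiTriple.

(** * The double sum as an Appell sum *)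

Section Appell.
Variables (A : comNzRingType) (K : nat) (q : A).
Hypothesis qK : q ^+ K = 0.
Local Notation pw := (pw q).
Local Notation sg := (@sg A).
Local Notation th := (theta q).
Local Notation geo := (geo K q).

(** sum_s (-1)^s q^(3 s^2 + s), Euler's pentagonal series for (q^2;q^2). *)
Definition eta : A := fsum (jacobi_term q 3 1).

(** k(k+2)/3 for k = 3t; the sign of the corresponding coefficient e_k is (-1)^t,
and e_k = 0 for k = 2 mod 3. *)
Definition expo0 (t : int) : int := 3 * t * t + 2 * t.
(** k(k+2)/3 for k = 3t + 1. *)
Definition expo1 (t : int) : int := 3 * t * t + 4 * t + 1.

Lemma sqz_ge0 (x : int) : 0 <= x * x. Proof. by rewrite -expr2 sqr_ge0. Qed.

Lemma sqzS_ge0 (x : int) : 0 <= x * x + x.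
Proof. by have [x0|x0] := leP 0 x; nia. Qed.

Lemma expo0_ge (t : int) : `|t|%N%:Z <= expo0 t.
Proof.
rewrite /expo0; have [t0|t0] := leP 0 t; first by nia.
have : 0 <= (- t) * (- t - 1) by rewrite mulr_ge0 //; lia.
by nia.
Qed.
Lemma expo1_ge (t : int) : `|t|%N%:Z <= expo1 t + 2.
Proof.
rewrite /expo1; have [t0|t0] := leP 0 t; first by nia.
have : 0 <= (- t - 1) * (- t - 1) by rewrite mulr_ge0 //; lia.
by nia.
Qed.
Lemma expo1_ge0 (t : int) : 0 <= expo1 t.
Proof.
rewrite /expo1; have [t0|t0] := leP 0 t; first by nia.
have : 0 <= (- t) * (- t - 1) by rewrite mulr_ge0 //; lia.
by nia.
Qed.
Lemma expo0_ge0 (t : int) : 0 <= expo0 t. Proof. exact: le_trans (expo0_ge t). Qed.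

Lemma sg2 (t : int) : sg (2 * t) = 1.
Proof. by rewrite (_ : 2 * t = t + t) ?sgD ?sgsg //; lia. Qed.

Lemma pw_fsupp (f : int -> int) (s : int -> A) (M : nat) :
  (forall t, (M <= `|t|)%N -> K%:Z <= f t) -> fsupp (fun t => s t * pw (f t)).
Proof.
by move=> fM; apply: (@vanish_fsupp _ M) => t /fM tM; rewrite (pw0 qK) ?mulr0.
Qed.

(** Coefficient of w^n in N(w) = sum_m (-1)^m q^(m^2+m) w^(2m). *)
Definition theta_num (n : int) : A :=
  if (2 %| n)%Z then sg (n %/ 2)%Z * pw ((n %/ 2)%Z * (n %/ 2)%Z + (n %/ 2)%Z) else 0.

Lemma theta_num_even m : theta_num (2 * m) = sg m * pw (m * m + m).
Proof.
rewrite /theta_num dvdz_mulr // mulKz //.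
Qed.

Lemma theta_num_odd m : theta_num (2 * m + 1) = 0.
Proof. by rewrite /theta_num; case: ifP => // H; exfalso; lia. Qed.

(** Coefficient of w^n in Theta(w) sum_t (u_t w^(3t) + v_t w^(3t+1)). *)
Definition theta_conv (u v : int -> A) (n : int) : A :=
  fsum (fun t => th (n - 3 * t) * u t) + fsum (fun t => th (n - 3 * t - 1) * v t).

(** The quintuple product identity in the form Theta(w) sum_k e_k w^k = eta N(w).
After completing squares both sums on the left are indexed by the same quadratic
exponent 3 s^2 - (3n-1) s: over s even and over s of the parity of n - 1. For odd n
they cancel; for even n they assemble to the alternating sum eta. *)
Lemma quintuple n :
  theta_conv (fun t => sg t * pw (expo0 t)) (fun t => sg t * pw (expo1 t)) n =
    eta * theta_num n.
Proof.
pose a t := (n - 3 * t) * (n - 3 * t) + expo0 t.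
pose b t := (n - 3 * t - 1) * (n - 3 * t - 1) + expo1 t.
have af : fsupp (fun t => sg n * pw (a t)).
  apply: (@pw_fsupp _ _ K) => t tK; rewrite /a; have := expo0_ge t;
    have := sqz_ge0 (n - 3 * t); lia.
have bf : fsupp (fun t => sg n * pw (b t)).
  apply: (@pw_fsupp _ _ K.+2) => t tK; rewrite /b; have := expo1_ge t;
    have := sqz_ge0 (n - 3 * t - 1); lia.
have -> : theta_conv (fun t => sg t * pw (expo0 t)) (fun t => sg t * pw (expo1 t)) n =
    fsum (fun t => sg n * pw (a t)) - fsum (fun t => sg n * pw (b t)).
  rewrite /theta_conv -fsumN //; congr (_ + _); apply: eq_fsum => t.
    rewrite /theta mulrACA -sgD -pwD ?expo0_ge0 ?sqz_ge0 //.
    by rewrite (_ : n - 3 * t + t = n - 2 * t) ?sgB ?sg2 ?mulr1 //; lia.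
  rewrite /theta mulrACA -sgD -pwD ?expo1_ge0 ?sqz_ge0 //.
  rewrite (_ : n - 3 * t - 1 + t = n - 1 - 2 * t); last by lia.
  by rewrite !sgB sg2 sg1 mulr1 mulrN1 mulNr.
have [[m nE]|[m nE]] := int_parity n; last first.
  rewrite [in RHS]nE theta_num_odd mulr0 [X in X - _](fsum_refl m).
  rewrite [X in X - _](_ : _ = fsum (fun t => sg n * pw (b t))) ?subrr //.
  by apply: eq_fsum => t; congr (_ * pw _); rewrite /a /b /expo0 /expo1 nE; nia.
have nE2 : sg n = 1 by rewrite nE sg2.
pose f (s : int) : A := sg s * pw (3 * (s - m) * (s - m) + (s - m) + (m * m + m)).
have f0 (s : int) : `|s - m|%R <= 3 * (s - m) * (s - m) + (s - m) + (m * m + m).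
  by have := @jacobi_exp_ge 3 1 isT (s - m); have := sqzS_ge0 m; lia.
have fE : eta * theta_num n = fsum f.
  rewrite [in LHS]nE theta_num_even /eta fsumMr; last first.
    by apply: (@vanish_fsupp _ K) => j; exact: jacobi_term0.
  rewrite (fsum_shift (- m)); apply: eq_fsum => s.
  rewrite /jacobi_term /f mulrACA -sgD -pwD ?sqzS_ge0 ?(@jacobi_exp_ge0 3 1) //.
  by congr (sg _ * pw _); lia.
rewrite fE fsum_parity; last first.
  apply: (@pw_fsupp _ _ (K + `|m|)) => s sK; have := f0 s; lia.
congr (_ + _).
  by apply: eq_fsum => t; rewrite /f sg2 nE2; congr (_ * pw _); rewrite /a /expo0 nE;
    nia.
rewrite -fsumN // (fsum_refl (m - 1)); apply: eq_fsum => t.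
rewrite /f sgS sg2 nE2 mul1r mulN1r; congr (- pw _); rewrite /b /expo1 nE; nia.
Qed.

(** Theta_(n+1-k) is - q^(2k-2n-1) Theta_(n-k), so the left-hand side is a multiple of
(1 - q^(2k)) q^e / (1 - q^(2k)). The exponents a and b, with a - b = 2n + 1, stand
for the power 2n + 1 of either sign. *)
Lemma theta_geo (n k e : int) (a b : nat) : k != 0 -> 0 <= e ->
    a%:Z - b%:Z = 2 * n + 1 ->
  q ^+ b * (th (n + 1 - k) * geo e (2 * k)) + q ^+ a * (th (n - k) * geo e (2 * k))
  = q ^+ b * (th (n + 1 - k) * pw e).
Proof.
move=> k0 e_ge ab.
have ok : geo_ok e (2 * k) by rewrite /geo_ok; case: ifP => // H; lia.
rewrite -!(pw_nat q) /theta.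
have -> : n + 1 - k = n - k + 1 by lia.
pose E := b%:Z + (n - k + 1) * (n - k + 1).
have E0 : 0 <= E by rewrite addr_ge0 ?sqz_ge0.
have E1 : a%:Z + (n - k) * (n - k) = E + 2 * k by rewrite /E; nia.
have -> : pw b%:Z * (sg (n - k + 1) * pw ((n - k + 1) * (n - k + 1)) * geo e (2 * k))
    = sg (n - k + 1) * geo (E + e) (2 * k).
  rewrite -mulrA mulrCA; congr (_ * _).
  by rewrite mulrA -pwD ?sqz_ge0 // geoM.
have -> : pw a%:Z * (sg (n - k) * pw ((n - k) * (n - k)) * geo e (2 * k))
    = sg (n - k) * geo (E + e + 2 * k) (2 * k).
  rewrite -mulrA mulrCA; congr (_ * _).
  rewrite mulrA -pwD ?sqz_ge0 // E1 geoM //; first by congr geo; lia.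
  by rewrite -E1 addr_ge0 ?sqz_ge0.
rewrite sgS; transitivity (- sg (n - k) * pw (E + e)).
  by rewrite -(@geoK _ _ _ qK (E + e) (2 * k)); [ring | lia | rewrite addr_ge0].
by rewrite [E + e]addrC pwD // /E pwD ?sqz_ge0 //; ring.
Qed.

(** e_k / (1 - q^(2k)) for k = 3t, which is 0 for k = 0. *)
Definition appell0 t := sg t * geo (expo0 t) (2 * (3 * t)).
(** e_k / (1 - q^(2k)) for k = 3t + 1. *)
Definition appell1 t := sg t * geo (expo1 t) (2 * (3 * t + 1)).

Lemma appell0_vanish (t : int) : (K <= `|t|)%N -> appell0 t = 0.
Proof.
move=> tK; rewrite /appell0 (geo0 qK) ?mulr0 //; have := expo0_ge t.
by case: ifP => ?; lia.
Qed.

Lemma appell1_vanish (t : int) : (K + 2 <= `|t|)%N -> appell1 t = 0.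
Proof.
move=> tK; rewrite /appell1 (geo0 qK) ?mulr0 //; have := expo1_ge t.
by case: ifP => ?; lia.
Qed.

Lemma appell0_mul_fsupp (G : int -> A) : fsupp (fun t => G t * appell0 t).
Proof. by apply: (@vanish_fsupp _ K) => t tK; rewrite appell0_vanish ?mulr0. Qed.

Lemma appell1_mul_fsupp (G : int -> A) : fsupp (fun t => G t * appell1 t).
Proof. by apply: (@vanish_fsupp _ (K + 2)) => t tK; rewrite appell1_vanish ?mulr0. Qed.

Lemma expo0_fsupp (G : int -> A) : fsupp (fun t => G t * (sg t * pw (expo0 t))).
Proof.
apply: (@vanish_fsupp _ K) => t tK; rewrite (pw0 qK) ?mulr0 //.
by have := expo0_ge t; lia.
Qed.

Lemma expo1_fsupp (G : int -> A) : fsupp (fun t => G t * (sg t * pw (expo1 t))).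
Proof.
apply: (@vanish_fsupp _ (K + 2)) => t tK; rewrite (pw0 qK) ?mulr0 //.
by have := expo1_ge t; lia.
Qed.

(** Dividing e_k by 1 - q^(2k) solves the functional equation with right-hand side
eta N(w), except for the missing term k = 0, which costs Theta(w). *)
Lemma theta_conv_rec (n : int) (a b : nat) : a%:Z - b%:Z = 2 * n + 1 ->
  q ^+ b * theta_conv appell0 appell1 (n + 1) + q ^+ a * theta_conv appell0 appell1 n
  = q ^+ b * (eta * theta_num (n + 1) - th (n + 1)).
Proof.
move=> ab; rewrite -quintuple /theta_conv.
pose u0 t := th (n + 1 - 3 * t) * (sg t * pw (expo0 t)).
pose v0 t := if t == 0 then 0 else u0 t.
have u0s : fsupp u0 by exact: expo0_fsupp.
have v0s : fsupp v0.
  by case: u0s => r u00; exists r => i /u00; rewrite /v0; case: ifP.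
(* the term t = 0 of the numerators has no counterpart on the left *)
have u0E : fsum u0 = th (n + 1) + fsum v0.
  have ds : fsupp (fun t : int => if t == 0 then th (n + 1) else 0).
    by exists [:: 0] => i; rewrite inE => /negPf ->.
  have -> : th (n + 1) = fsum (fun t : int => if t == 0 then th (n + 1) else 0).
    rewrite (@fsumE _ _ [:: 0]) ?big_seq1 ?eqxx // => i.
    by rewrite inE => /negPf ->.
  rewrite -fsumD //; apply: eq_fsum => t; rewrite /v0.
  case: eqP => [->|_]; last by rewrite add0r.
  by rewrite addr0 /u0 mulr0 subr0 /expo0 !mulr0 addr0 /pw expr0 mulr1 sg0 mulr1.
rewrite -/u0 -[fsum (fun t => th (n + 1 - 3 * t) * (sg t *
  pw (expo0 t)))]/(fsum u0) u0E.
rewrite [_ + _ - th _]addrAC [th _ + _ - _]addrAC subrr add0r.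
rewrite !mulrDr addrACA !fsumMl; try solve [exact: appell0_mul_fsupp | exact:
  appell1_mul_fsupp | exact: expo1_fsupp | exact: v0s].
rewrite -!fsumD; try solve [exact/fsuppM/appell0_mul_fsupp |
  exact/fsuppM/appell1_mul_fsupp |
  exact/fsuppM/v0s | exact/fsuppM/expo1_fsupp |
  apply: fsuppD; [exact/fsuppM/appell0_mul_fsupp | exact/fsuppM/appell0_mul_fsupp] |
  apply: fsuppD; [exact/fsuppM/appell1_mul_fsupp | exact/fsuppM/appell1_mul_fsupp]].
apply: eq_fsum => t; congr (_ + _).
  rewrite /v0; case: eqP => [->|t0].
    have -> : appell0 0 = 0 by rewrite /appell0 mulr0.
    by rewrite !mulr0 addr0.
  rewrite /u0 /appell0; have t0' : 3 * t != 0 by lia.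
  have := @theta_geo n (3 * t) (expo0 t) a b t0' (expo0_ge0 t) ab.
  move=> /(congr1 ( *%R (sg t))) E.
  transitivity (sg t * (q ^+ b * (th (n + 1 - 3 * t) * geo (expo0 t) (2 * (3 * t))) +
    q ^+ a * (th (n - 3 * t) * geo (expo0 t) (2 * (3 * t))))); first by ring.
  by rewrite E; ring.
have t0' : 3 * t + 1 != 0 by lia.
have := @theta_geo n (3 * t + 1) (expo1 t) a b t0' (expo1_ge0 t) ab.
rewrite /appell1 (_ : n + 1 - (3 * t + 1) = n + 1 - 3 * t - 1); last by lia.
rewrite (_ : n - (3 * t + 1) = n - 3 * t - 1); last by lia.
move=> /(congr1 ( *%R (sg t))) E.
transitivity (sg t * (q ^+ b * (th (n + 1 - 3 * t - 1) * geo (expo1 t) (2 * (3 * t +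
  1))) +
    q ^+ a * (th (n - 3 * t - 1) * geo (expo1 t) (2 * (3 * t + 1))))); first by ring.
by rewrite E; ring.
Qed.

Lemma theta_step (n : int) (a b : nat) : a%:Z - b%:Z = 2 * n + 1 ->
  q ^+ b * th (n + 1) = - (q ^+ a * th n).
Proof.
move=> ab; rewrite /theta sgS mulNr mulrN !(mulrCA (q ^+ _)); congr (- (_ * _)).
by rewrite -(pw_nat q b) -(pw_nat q a) -!pwD ?sqz_ge0 //; congr pw; lia.
Qed.

(** With right-hand side Theta(w), the solutions are Theta(w) X_0 + w Theta'(w). *)
Lemma theta_rec_solve (X : int -> A) :
  (forall (n : int) (a b : nat), a%:Z - b%:Z = 2 * n + 1 ->
     q ^+ b * X (n + 1) + q ^+ a * X n = q ^+ b * th (n + 1)) ->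
  forall n, X n = th n * (X 0 + n%:~R).
Proof.
move=> rec; case=> n.
  elim: n => [|n IHn]; first by rewrite /theta mulr0 /pw expr0 sg0 !mul1r addr0.
  have := rec n%:Z (2 * n + 1)%N 0%N; rewrite expr0 !mul1r IHn => E.
  have {}E := E ltac:(lia); apply: (addIr (q ^+ (2 * n + 1) * (th n * (X 0 + n%:~R)))).
  have -> : n.+1%:Z = n%:Z + 1 by lia.
  have := @theta_step n (2 * n + 1) 0 ltac:(lia); rewrite expr0 mul1r => E'.
  by rewrite E mulrA -[q ^+ _ * th n]opprK -E' intrD; ring.
elim: n => [|n IHn].
  have := rec (-1) 0%N 1%N ltac:(lia); rewrite expr0 expr1 mul1r addNr.
  rewrite [th 0]/theta mulr0 /pw expr0 sg0 mulr1 => E.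
  have -> : Negz 0 = -1 by [].
  have th1 : th (-1) = - q by rewrite /theta sgN sg1 /pw expr1 mulN1r.
  by apply: (addrI (q * X 0)); rewrite E th1 rmorphN rmorph1; ring.
have := rec (Negz n.+1) 0%N (2 * n + 3)%N ltac:(lia); rewrite expr0 mul1r.
have -> : Negz n.+1 + 1 = Negz n by lia.
rewrite IHn => E; apply: (addrI (q ^+ (2 * n + 3) * (th (Negz n) * (X 0 +
  (Negz n)%:~R)))).
have := @theta_step (Negz n.+1) 0 (2 * n + 3) ltac:(lia); rewrite expr0 mul1r.
have E2 : Negz n.+1 + 1 = Negz n by lia.
rewrite E E2 => E'; rewrite mulrA E' -E2 intrD; ring.
Qed.

Lemma theta_mul_fsupp (G : int -> A) : fsupp (fun n => th n * G n).
Proof. by apply: (@vanish_fsupp _ K) => n nK; rewrite (theta0 qK) ?mul0r. Qed.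

Lemma theta_fsupp : fsupp th.
Proof. by apply: (@vanish_fsupp _ K) => n nK; rewrite (theta0 qK). Qed.

(** w Theta'(w) vanishes at w = 1 because Theta(1/w) = Theta(w). *)
Lemma fsum_theta_deriv : fsum (fun n => th n * n%:~R) = 0.
Proof.
rewrite fsum_int; last exact: theta_mul_fsupp.
rewrite fsum_recl; last first.
  apply: (@fsupp_nat _ K) => n nK; rewrite (theta0 qK) ?mul0r //.
rewrite mulr0 add0r -[RHS](subrr (fsum (fun n : nat => th n.+1%:Z * n.+1%:~R))).
congr (_ + _); rewrite -fsumN.
  apply: eq_fsum => n; rewrite /theta sgN mulrNN rmorphN mulrN //.
apply: (@fsupp_nat _ K) => n nK; rewrite (theta0 qK) ?mul0r //; lia.
Qed.

Lemma theta_conv_sum : fsum (theta_conv appell0 appell1) =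
  fsum th * (fsum appell0 + fsum appell1).
Proof.
pose F0 (n t : int) := th (n - 3 * t) * appell0 t.
pose F1 (n t : int) := th (n - 3 * t - 1) * appell1 t.
have s0 : fsupp (fun x : int * int => F0 x.1 x.2).
  apply: (@vanish_fsupp2 _ (4 * K)) => n t nt; rewrite /F0.
  have [tK|tK] := leqP K `|t|; first by rewrite appell0_vanish ?mulr0.
  by rewrite (theta0 qK) ?mul0r //; lia.
have s1 : fsupp (fun x : int * int => F1 x.1 x.2).
  apply: (@vanish_fsupp2 _ (4 * K + 9)) => n t nt; rewrite /F1.
  have [tK|tK] := leqP (K + 2) `|t|; first by rewrite appell1_vanish ?mulr0.
  by rewrite (theta0 qK) ?mul0r //; lia.
rewrite /theta_conv fsumD; [|exact: (fsupp_fst s0)|exact: (fsupp_fst s1)].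
rewrite (fsum_exchange s0) (fsum_exchange s1) mulrDr !fsumMl; last 2 first.
- by apply: (@vanish_fsupp _ (K + 2)) => t; exact: appell1_vanish.
- by apply: (@vanish_fsupp _ K) => t; exact: appell0_vanish.
congr (_ + _); apply: eq_fsum => t; rewrite fsumMr; try exact: theta_fsupp.
  rewrite (fsum_shift (3 * t)); apply: eq_fsum => n.
  by rewrite /F0; congr (th _ * _); lia.
rewrite (fsum_shift (3 * t + 1)); apply: eq_fsum => n.
by rewrite /F1; congr (th _ * _); lia.
Qed.

(** The summand of [hecke_sum] coming from q^r, with r = m + j + 1; it enters the
coefficient g_n with n = 2m + 2 + j. *)
Definition hecke_pos m j : A := (-1) ^+ (m + j).+1 *
  q ^+ ((m + j).+1 * (m + j).+1 + (m + j).+1 + (2 * m + 1) * j).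
(** The summand of [hecke_sum] coming from 1; it enters g_(-p) with p = m + 2j + 1. *)
Definition hecke_neg m j : A := (-1) ^+ (m + j) *
  q ^+ ((m + j).+1 * (m + j).+1 + (2 * m + 1) * j).

Definition coef_pos n : A :=
  fsum (fun m => if (2 * m + 2 <= n)%N then hecke_pos m (n - (2 * m + 2)) else 0).
Definition coef_neg p : A :=
  fsum (fun j => if (2 * j + 1 <= p)%N then hecke_neg (p - (2 * j + 1)) j else 0).
(** The coefficients g_n. In the lattice of the quadratic form of the double sum this
cuts the same cone along orthogonal directions, one of which carries n^2. *)
Definition hecke_coef (n : int) : A := match n with Posz n => coef_pos n | Negz n =>
  coef_neg n.+1 end.

Lemma hecke_pos0 m j : (K <= m + j)%N -> hecke_pos m j = 0.
Proof. by move=> H; rewrite /hecke_pos (nil_exp qK) ?mulr0 //; nia. Qed.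
Lemma hecke_neg0 m j : (K <= m + j)%N -> hecke_neg m j = 0.
Proof. by move=> H; rewrite /hecke_neg (nil_exp qK) ?mulr0 //; nia. Qed.

Lemma coef_pos_fsupp n : fsupp (fun m => if (2 * m +
  2 <= n)%N then hecke_pos m (n - (2 * m + 2)) else 0).
Proof. by apply: (@fsupp_nat _ n) => m nm; case: ifP => //; lia. Qed.
Lemma coef_neg_fsupp p : fsupp (fun j => if (2 * j +
  1 <= p)%N then hecke_neg (p - (2 * j + 1)) j else 0).
Proof. by apply: (@fsupp_nat _ p) => m nm; case: ifP => //; lia. Qed.

Lemma coef_pos0 : coef_pos 0 = 0.
Proof. by apply: fsum0 => m; case: ifP => //; lia. Qed.
Lemma coef_neg0 : coef_neg 0 = 0.
Proof. by apply: fsum0 => m; case: ifP => //; lia. Qed.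

(** Terms with the same m cancel; the one that has no partner, 2m + 2 = n + 1, is the
coefficient of N(w). *)
Lemma coef_posS n : coef_pos n.+1 + q ^+ (2 * n + 1) * coef_pos n = theta_num n.+1.
Proof.
rewrite /coef_pos fsumMl; last exact: coef_pos_fsupp.
rewrite -fsumD; [|exact: coef_pos_fsupp|exact/fsuppM/coef_pos_fsupp].
have hE m : (if (2 * m + 2 <= n.+1)%N then hecke_pos m (n.+1 - (2 * m + 2)) else 0) +
    q ^+ (2 * n + 1) * (if (2 * m + 2 <= n)%N then hecke_pos m (n - (2 * m + 2)) else 0)
    = if (2 * m + 2 == n.+1)%N then hecke_pos m 0 else 0.
  case: eqP => [E|E].
    by rewrite E ltnn leqnn subnn mulr0 addr0.
  case: ifP => H1; last by rewrite ifF ?mulr0 ?addr0 //; lia.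
  rewrite ifT; last by lia.
  have -> : (n.+1 - (2 * m + 2) = (n - (2 * m + 2)).+1)%N by lia.
  have -> : (2 * n + 1 = 2 * (n - (2 * m + 2) + (2 * m + 2)) + 1)%N by lia.
  move: (n - _)%N => j.
  rewrite /hecke_pos [q ^+ _ * (_ * _)]mulrCA -exprD addnS [(-1) ^+ (m +
    j).+2]exprS mulN1r mulNr addrC.
  apply/eqP; rewrite subr_eq0; apply/eqP; congr (_ * _ ^+ _); lia.
rewrite (eq_fsum hE); have [[m nE]|[m nE]] := int_parity n.+1%:Z; last first.
  rewrite nE theta_num_odd; apply: fsum0 => k; case: eqP => // kE; exfalso; lia.
have [k mE] : exists k : nat, m = k%:Z + 1 by exists (absz (m - 1)); lia.
rewrite (@fsumE _ _ [:: k]) // => [|i]; last first.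
  by rewrite inE => ik; case: eqP => // iE; exfalso; lia.
rewrite big_seq1 ifT; last by lia.
rewrite nE theta_num_even mE /hecke_pos muln0 !addn0 /sg (_ : absz (k%:Z + 1) = k.+1);
  last by lia.
by congr (_ * _ ^+ _); lia.
Qed.

(** As [coef_posS], with m and j exchanged. *)
Lemma coef_negS p : coef_neg p.+1 + q ^+ (2 * p + 1) * coef_neg p =
  q ^+ (2 * p + 1) * theta_num (- p%:Z).
Proof.
rewrite /coef_neg fsumMl; last exact: coef_neg_fsupp.
rewrite -fsumD; [|exact: coef_neg_fsupp|exact/fsuppM/coef_neg_fsupp].
have hE j : (if (2 * j + 1 <= p.+1)%N then hecke_neg (p.+1 - (2 * j + 1)) j else 0) +
    q ^+ (2 * p + 1) * (if (2 * j + 1 <= p)%N then hecke_neg (p - (2 * j + 1)) j else 0)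
    = if (2 * j + 1 == p.+1)%N then hecke_neg 0 j else 0.
  case: eqP => [E|E].
    by rewrite E ltnn leqnn subnn mulr0 addr0.
  case: ifP => H1; last by rewrite ifF ?mulr0 ?addr0 //; lia.
  rewrite ifT; last by lia.
  have -> : (p.+1 - (2 * j + 1) = (p - (2 * j + 1)).+1)%N by lia.
  have -> : (2 * p + 1 = 2 * (p - (2 * j + 1) + (2 * j + 1)) + 1)%N by lia.
  move: (p - _)%N => m.
  rewrite /hecke_neg [q ^+ _ * (_ * _)]mulrCA -exprD addSn [(-1) ^+ (m +
    j).+1]exprS mulN1r mulNr addrC.
  apply/eqP; rewrite subr_eq0; apply/eqP; congr (_ * _ ^+ _); lia.
rewrite (eq_fsum hE); have [[m pE]|[m pE]] := int_parity p%:Z; last first.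
  have -> : - p%:Z = 2 * (- m - 1) + 1 by lia.
  rewrite theta_num_odd mulr0; apply: fsum0 => k; case: eqP => // kE; exfalso; lia.
have [k mE] : exists k : nat, m = k%:Z by exists `|m|%N; lia.
have -> : - p%:Z = 2 * (- m) by lia.
rewrite (@fsumE _ _ [:: k]) // => [|i]; last first.
  by rewrite inE => ik; case: eqP => // iE; exfalso; lia.
rewrite big_seq1 ifT; last by lia.
rewrite theta_num_even mE sgN /hecke_neg add0n mulrCA; congr (_ * _).
rewrite -(pw_nat q (2 * p + 1)) -pwD //; last exact: sqzS_ge0.
by rewrite -pw_nat; congr pw; lia.
Qed.

Lemma hecke_coef_rec (n : int) (a b : nat) : a%:Z - b%:Z = 2 * n + 1 ->
  q ^+ b * hecke_coef (n + 1) + q ^+ a * hecke_coef n = q ^+ b * theta_num (n + 1).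
Proof.
case: n => n ab.
  have -> : n%:Z + 1 = n.+1%:Z by lia.
  have -> : a = (b + (2 * n + 1))%N by lia.
  by rewrite -coef_posS exprD /=; ring.
have bE : b = (a + (2 * n + 1))%N by lia.
have -> : Negz n + 1 = - n%:Z by lia.
have -> : hecke_coef (- n%:Z) = coef_neg n by case: (n) => [|k];
  rewrite /= ?coef_neg0 ?coef_pos0.
rewrite bE exprD; transitivity (q ^+ a * (coef_neg n.+1 + q ^+ (2 * n +
  1) * coef_neg n)).
  by rewrite /=; ring.
by rewrite coef_negS; ring.
Qed.

Lemma hecke_coef_sum : fsum hecke_coef = hecke_sum q.
Proof.
pose hh m j := hecke_neg m j + hecke_pos m j.
have sp : fsupp (fun x : nat * nat => hecke_pos x.1 x.2).
  by apply: (@fsupp_nat2 _ K) => m j mj; apply: hecke_pos0; lia.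
have sm : fsupp (fun x : nat * nat => hecke_neg x.1 x.2).
  by apply: (@fsupp_nat2 _ K) => m j mj; apply: hecke_neg0; lia.
pose Gp n m := if (2 * m + 2 <= n)%N then hecke_pos m (n - (2 * m + 2)) else 0.
pose Gm p j := if (2 * j + 1 <= p)%N then hecke_neg (p - (2 * j + 1)) j else 0.
have sGp : fsupp (fun x : nat * nat => Gp x.1 x.2).
  apply: (@fsupp_nat2 _ (2 * K + 9)) => n m nm; rewrite /Gp; case: ifP => // H.
  by apply: hecke_pos0; lia.
have sGm : fsupp (fun x : nat * nat => Gm x.1 x.2).
  apply: (@fsupp_nat2 _ (2 * K + 9)) => n m nm; rewrite /Gm; case: ifP => // H.
  by apply: hecke_neg0; lia.
have gpE : fsum coef_pos = fsum (fun m => fsum (hecke_pos m)).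
  rewrite [LHS](fsum_exchange sGp); apply: eq_fsum => m.
  exact: (fsum_nat_shift (2 * m + 2) (hecke_pos m)).
have gmE : fsum coef_neg = fsum (fun m => fsum (hecke_neg m)).
  rewrite [LHS](fsum_exchange sGm) (fsum_exchange sm); apply: eq_fsum => j.
  exact: (fsum_nat_shift (2 * j + 1) (hecke_neg^~ j)).
have gmE' : fsum (fun n => coef_neg n.+1) = fsum coef_neg.
  rewrite [RHS]fsum_recl ?coef_neg0 ?add0r //.
  exact: (fsupp_fst sGm).
have gs : fsupp hecke_coef.
  apply: (@vanish_fsupp _ (2 * K + 9)) => -[] n nK /=; apply: fsum0 => m.
    by case: ifP => // H; apply: hecke_pos0; lia.
  by case: ifP => // H; apply: hecke_neg0; lia.
rewrite fsum_int // -[fsum (fun n : nat => hecke_coef n%:Z)]/(fsum coef_pos).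
rewrite -[fsum (fun n : nat => hecke_coef (- n.+1%:Z))]/(fsum (fun n =>
  coef_neg n.+1)) gmE' gpE gmE.
rewrite -fsumD; [|exact: fsupp_fst|exact: fsupp_fst].
pose H r m := if (m <= r)%N then hecke_pos m (r - m) + hecke_neg m (r - m) else 0.
have sH : fsupp (fun x : nat * nat => H x.1 x.2).
  apply: (@fsupp_nat2 _ K) => r m rm; rewrite /H; case: ifP => // Hm.
  by rewrite hecke_pos0 ?hecke_neg0 ?addr0 //; lia.
transitivity (fsum (fun m => fsum (H^~ m))).
  apply: eq_fsum => m; rewrite (fsum_nat_shift m (fun j =>
    hecke_pos m j + hecke_neg m j)) fsumD //.
    exact: (fsupp_snd m sp).
  exact: (fsupp_snd m sm).
rewrite -(fsum_exchange sH); apply: eq_fsum => r.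
rewrite (@fsum_nat _ r.+1) => [|m rm]; last by rewrite /H; case: ifP => //; lia.
rewrite /hecke_row mulr_sumr; apply: eq_bigr => m _.
have mr : (m <= r)%N by rewrite -ltnS.
rewrite /H mr /hecke_pos /hecke_neg subnKC // exprS !exprD /=.
by ring.
Qed.

(** eta g(w) and the convolution of Theta with e_k / (1 - q^(2k)) differ by a solution
of [theta_rec_solve]; evaluate at w = 1. *)
Theorem appell_form :
  eta * hecke_sum q = fsum th * (fsum appell0 + fsum appell1 -
    theta_conv appell0 appell1 0).
Proof.
pose X n := eta * hecke_coef n - theta_conv appell0 appell1 n.
have Xrec (n : int) (a b : nat) : a%:Z - b%:Z = 2 * n + 1 ->
     q ^+ b * X (n + 1) + q ^+ a * X n = q ^+ b * th (n + 1).
  move=> ab; have E1 := hecke_coef_rec ab; have E2 := theta_conv_rec ab.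
  transitivity (eta * (q ^+ b * hecke_coef (n + 1) + q ^+ a * hecke_coef n) -
    (q ^+ b * theta_conv appell0 appell1 (n + 1) + q ^+ a *
      theta_conv appell0 appell1 n)); first by rewrite /X; ring.
  by rewrite E1 E2; ring.
have XE := theta_rec_solve Xrec.
have X0 : X 0 = - theta_conv appell0 appell1 0 by rewrite /X /= coef_pos0 mulr0 sub0r.
have sc : fsupp (theta_conv appell0 appell1).
  apply: (@vanish_fsupp _ (4 * K + 9)) => n nK; rewrite /theta_conv !fsum0 ?addr0 //
    => t.
    have [tK|tK] := leqP (K + 2) `|t|; first by rewrite appell1_vanish ?mulr0.
    by rewrite (theta0 qK) ?mul0r //; lia.
  have [tK|tK] := leqP K `|t|; first by rewrite appell0_vanish ?mulr0.
  by rewrite (theta0 qK) ?mul0r //; lia.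
have gE n : eta * hecke_coef n = th n * X 0 + th n * n%:~R +
  theta_conv appell0 appell1 n.
  by rewrite -mulrDr -XE /X subrK.
have sg' : fsupp hecke_coef.
  apply: (@vanish_fsupp _ (2 * K + 9)) => -[] n nK /=; apply: fsum0 => m.
    by case: ifP => // H; apply: hecke_pos0; lia.
  by case: ifP => // H; apply: hecke_neg0; lia.
rewrite -hecke_coef_sum fsumMl // (eq_fsum gE) fsumD //; last first.
  by apply: fsuppD; exact: theta_mul_fsupp.
rewrite fsumD; [|exact: theta_mul_fsupp|exact: theta_mul_fsupp].
rewrite fsum_theta_deriv addr0 theta_conv_sum -fsumMr; last exact: theta_fsupp.
by rewrite X0; ring.
Qed.

End Appell.

(** * The odd part as a Lambert series *)

Section OddPart.
Variables (A : comNzRingType) (K : nat) (q : A).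
Hypothesis qK : q ^+ K = 0.
Local Notation sg := (@sg A).

Lemma nilN : (- q) ^+ K = 0. Proof. by rewrite exprNn qK mulr0. Qed.

Lemma pw_opp e : pw (- q) e = sg e * pw q e.
Proof. by rewrite /pw exprNn. Qed.

Lemma sg_even e : (2 %| e)%Z -> sg e = 1.
Proof. by move=> H; rewrite (_ : e = 2 * (e %/ 2)%Z) ?sg2 //; lia. Qed.

Lemma sg_eq a b : (2 %| a - b)%Z -> sg a = sg b.
Proof. by move=> /sg_even H; rewrite -[a](subrK b) sgD H mul1r. Qed.

Lemma geo_opp e v : (2 %| v)%Z -> geo K (- q) e v = sg e * geo K q e v.
Proof.
move=> v2; have gE : ginv K (- q) `|v|%N = ginv K q `|v|%N.
  apply: eq_bigr => i _; rewrite exprNn -signr_odd (_ : odd _ = false) ?mul1r //.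
  lia.
rewrite /geo gE !pw_opp; case: ifP => _; first by rewrite mulrA.
case: ifP => _; last by rewrite mulr0.
by rewrite mulrN mulrA (@sg_eq (e - v) e) //; lia.
Qed.

Lemma sg_sq n : sg (n * n) = sg n.
Proof. by rewrite /sg abszM -signr_odd oddM andbb signr_odd. Qed.

Lemma theta_opp n : theta (- q) n = sg n * theta q n.
Proof. by rewrite /theta pw_opp sg_sq. Qed.

Lemma eta_opp : eta (- q) = eta q.
Proof.
apply: eq_fsum => j; rewrite /jacobi_term pw_opp sgD mulrA; congr (_ * _).
have -> : sg (3%:Z * j * j) = sg j.
  by rewrite -mulrA (_ : 3 * (j * j) = j * j + 2 * (j *
    j)) ?sgD ?sg2 ?mulr1 ?sg_sq //; lia.
by rewrite mul1r sgsg mulr1.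
Qed.

Lemma sg_expo0 t : sg (expo0 t) = sg t.
Proof.
rewrite /expo0 (_ : 3 * t * t + 2 * t = t * t + 2 * (t * t + t)); last by lia.
by rewrite sgD sg2 mulr1 sg_sq.
Qed.

Lemma sg_expo1 t : sg (expo1 t) = - sg t.
Proof.
rewrite /expo1 (_ : 3 * t * t + 4 * t + 1 = t * t + 2 * (t * t + 2 * t) + 1);
  last by lia.
by rewrite sgS sgD sg2 mulr1 sg_sq.
Qed.

Lemma appell0_opp t : appell0 K (- q) t = sg t * appell0 K q t.
Proof. by rewrite /appell0 geo_opp ?sg_expo0 //; lia. Qed.

Lemma appell1_opp t : appell1 K (- q) t = - sg t * appell1 K q t.
Proof. by rewrite /appell1 geo_opp ?sg_expo1; [ring | lia]. Qed.

(** The constant of integration is even in q: it drops out of the odd part of sigma. *)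
Lemma theta_conv_opp : theta_conv (- q) (appell0 K (- q)) (appell1 K (- q)) 0 =
  theta_conv q (appell0 K q) (appell1 K q) 0.
Proof.
rewrite /theta_conv; congr (_ + _); apply: eq_fsum => t.
  rewrite theta_opp appell0_opp mulrACA -sgD (_ : 0 - 3 * t + t =
    2 * (- t)) ?sg2 ?mul1r //; lia.
rewrite theta_opp appell1_opp mulrACA mulrN -sgD -sgS.
by rewrite (_ : 0 - 3 * t - 1 + t + 1 = 2 * (- t)) ?sg2 ?mul1r //; lia.
Qed.

Lemma gauss_theta : fsum (theta q) * (qfac_opp q K * iqfac K q K) = 1.
Proof.
have -> : fsum (theta q) = fsum (jacobi_term q 1 0).
  by apply: eq_fsum => n; rewrite /theta /jacobi_term mul1r mul0r addr0.
rewrite (@jacobi_triple _ _ _ qK 1 0) // muln1 subn0 addn0.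
have E1 : qprod K q 1 1 = qfac q K.
  by apply: eq_bigr => i _; rewrite mul1n addn1.
have E2 : qfac_opp q K * qprod K q 1 1 = qprod K q 2 2.
  rewrite -big_split; apply: eq_bigr => i _ /=.
  have -> : (1 * i + 1 = i.+1)%N by lia.
  have -> : (2 * i + 2 = i.+1 * 2)%N by lia.
  by rewrite exprM expr2; ring.
have E3 : qprod K q 1 1 = qprod K q 1 2 * qprod K q 2 2.
  by rewrite (@qprod_split _ _ _ qK 2) // !big_ord_recr big_ord0 /= mul1r.
have [v v1] := @qprod_unit _ _ _ qK 2 2 isT.
have E4 : qfac_opp q K * qprod K q 1 2 = 1.
  rewrite -[LHS]mulr1 -v1; transitivity (qfac_opp q K * qprod K q 1 1 * v).
    by rewrite E3; ring.
  by rewrite E2.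
transitivity (qfac_opp q K * qprod K q 1 2 * (qprod K q 1 2 * qprod K q 2 2 *
  iqfac K q K)).
  by ring.
by rewrite E4 -E3 E1 (qfacK qK) mulr1.
Qed.

Lemma sigma_appell : eta q * sigma_at K q =
  fsum (appell0 K q) + fsum (appell1 K q) - theta_conv q (appell0 K q) (appell1 K q) 0.
Proof.
rewrite (sigma_hecke qK) mulrCA (appell_form qK) mulrA [_ * fsum _]mulrC.
by rewrite gauss_theta mul1r.
Qed.

Lemma appell0_fsupp : fsupp (appell0 K q).
Proof. by apply: (@vanish_fsupp _ K) => t; exact: appell0_vanish. Qed.
Lemma appell1_fsupp : fsupp (appell1 K q).
Proof. by apply: (@vanish_fsupp _ (K + 2)) => t; exact: appell1_vanish. Qed.

Definition appell_odd : A :=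
  fsum (fun t => appell0 K q (2 * t + 1)) + fsum (fun t => appell1 K q (2 * t)).

End OddPart.

Section OddPart2.
Variables (A : comNzRingType) (K : nat) (q : A).
Hypothesis qK : q ^+ K = 0.
Local Notation sg := (@sg A).

(** e_k / (1 - q^(2k)) has the parity of k as a function of q. *)
Lemma sigma_odd : eta q * (sigma_at K q - sigma_at K (- q)) = 2 * appell_odd K q.
Proof.
have sy0 : fsupp (fun t => sg t * appell0 K q t) by apply: appell0_mul_fsupp.
have sy1 : fsupp (fun t => - sg t * appell1 K q t) by apply: appell1_mul_fsupp.
rewrite mulrBr -{2}eta_opp !sigma_appell ?nilN // theta_conv_opp.
rewrite (eq_fsum (@appell0_opp _ K q)) (eq_fsum (@appell1_opp _ K q)).
have -> : forall a b c d e : A, a + b - c - (d + e - c) = a - d + (b - e).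
  by move=> *; ring.
rewrite -!fsumB //; try solve [exact: appell0_fsupp | exact: appell1_fsupp].
rewrite fsum_parity; last by apply: fsuppB => //; exact: appell0_fsupp.
rewrite [X in _ + X]fsum_parity; last by apply: fsuppB => //; exact: appell1_fsupp.
rewrite [X in X + _ + _]fsum0 => [|t]; last by rewrite sg2 mul1r subrr.
rewrite [X in _ + (_ + X)]fsum0 => [|t]; last by rewrite sgS sg2 opprK mul1r subrr.
rewrite add0r addr0 mulrDr !fsumMl; last 2 first.
- apply: (@vanish_fsupp _ (K + 2)) => t tK; apply: appell1_vanish => //; lia.
- apply: (@vanish_fsupp _ (K + 2)) => t tK; apply: appell0_vanish => //; lia.
congr (_ + _); apply: eq_fsum => t; first by rewrite sgS sg2; ring.
by rewrite sg2; ring.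
Qed.

(** Each half of the square, on either side of the diagonal, is parametrised by the
distance to the diagonal. *)
Lemma fsum_fold (F : nat -> nat -> A) : fsupp (fun x : nat * nat => F x.1 x.2) ->
  fsum (fun s => fsum (F s)) = fsum (fun s => fsum (fun i => F s (s + i)%N)) +
    fsum (fun s => fsum (fun i => F (s + i.+1)%N s)).
Proof.
move=> Fs; pose F1 s i := if (s <= i)%N then F s i else 0.
pose F2 s i := if (i.+1 <= s)%N then F s i else 0.
have F1s : fsupp (fun x : nat * nat => F1 x.1 x.2).
  by case: Fs => r r0; exists r => x /r0 Fx; rewrite /F1 Fx; case: ifP.
have F2s : fsupp (fun x : nat * nat => F2 x.1 x.2).
  by case: Fs => r r0; exists r => x /r0 Fx; rewrite /F2 Fx; case: ifP.
transitivity (fsum (fun s => fsum (F1 s)) + fsum (fun s => fsum (F2 s))).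
  rewrite -fsumD; [|exact: fsupp_fst|exact: fsupp_fst].
  apply: eq_fsum => s; rewrite -fsumD; [|exact: (@fsupp_snd _ _ _ F1 s)|exact:
    (@fsupp_snd _ _ _ F2 s)].
  by apply: eq_fsum => i; rewrite /F1 /F2; case: ltnP; rewrite ?addr0 ?add0r.
congr (_ + _).
  apply: eq_fsum => s; rewrite -[RHS](fsum_nat_shift s); apply: eq_fsum => i.
  by rewrite /F1; case: ifP => // si; rewrite subnKC.
rewrite (fsum_exchange F2s); apply: eq_fsum => i.
rewrite -[RHS](fsum_nat_shift i.+1); apply: eq_fsum => s.
by rewrite /F2; case: ifP => // si; congr F; lia.
Qed.

Lemma geo_series e v : (0 < v)%N ->
  q ^+ e * ginv K q v = fsum (fun i => q ^+ (e + v * i)).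
Proof.
move=> v0; rewrite (@fsum_nat _ K) => [|i Ki]; last by rewrite (nil_exp qK) //; nia.
by rewrite mulr_sumr; apply: eq_bigr => i _; rewrite exprD.
Qed.

(** sum over n in Z of q^(6n+1) / (1 - q^(12n+2)). *)
Definition lambert : A := fsum (fun k => geo K q (6 * k + 1) (12 * k + 2)).

(** Expanding the denominators, the four families of odd k (its sign, and its class
modulo 3) give the halves s <= i and i < s of the double series with terms
q^((6s+1)(2i+1)) and - q^((6s+5)(2i+1)). *)
Lemma appell_odd_lambert : appell_odd K q = lambert.
Proof.
pose F1 s i : A := q ^+ ((6 * s + 1) * (2 * i + 1)).
pose F5 s i : A := q ^+ ((6 * s + 5) * (2 * i + 1)).
have F1s : fsupp (fun x : nat * nat => F1 x.1 x.2).
  by apply: (@fsupp_nat2 _ K) => m n mn; rewrite /F1 (nil_exp qK) //; nia.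
have F5s : fsupp (fun x : nat * nat => F5 x.1 x.2).
  by apply: (@fsupp_nat2 _ K) => m n mn; rewrite /F5 (nil_exp qK) //; nia.
have a0 : fsum (fun t => appell0 K q (2 * t + 1)) =
    - fsum (fun s => fsum (fun i => F5 (s + i)%N s)) +
      fsum (fun s => fsum (fun i => F1 (s + i.+1)%N s)).
  rewrite fsum_int; last first.
    by apply: (@vanish_fsupp _ (K + 2)) => t tK; apply: appell0_vanish => //; lia.
  rewrite -fsumN; last first.
    apply: (@fsupp_fst A nat nat (fun s i => F5 (s + i)%N s)).
    by apply: (@fsupp_nat2 _ K (fun s i => F5 (s + i)%N s)) => m n mn;
      rewrite /F5 (nil_exp qK) //; nia.
  congr (_ + _); apply: eq_fsum => s.
    rewrite /appell0 sgS sg2 mulN1r /geo ifT; last by lia.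
    rewrite /pw geo_series; last by lia.
    congr (- _); apply: eq_fsum => i; rewrite /F5 /expo0; congr (_ ^+ _); lia.
  rewrite /appell0 sgS sg2 mulN1r /geo ifF ?ifT ?opprK; [|lia|lia].
  rewrite /pw geo_series; last by lia.
  apply: eq_fsum => i; rewrite /F1 /expo0; congr (_ ^+ _); lia.
have a1 : fsum (fun t => appell1 K q (2 * t)) =
    fsum (fun s => fsum (fun i => F1 s (s + i)%N)) -
      fsum (fun s => fsum (fun i => F5 s (s + i.+1)%N)).
  rewrite fsum_int; last first.
    by apply: (@vanish_fsupp _ (K + 2)) => t tK; apply: appell1_vanish => //; lia.
  rewrite -fsumN; last first.
    apply: (@fsupp_fst A nat nat (fun s i => F5 s (s + i.+1)%N)).
    by apply: (@fsupp_nat2 _ K (fun s i => F5 s (s + i.+1)%N)) => m n mn;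
      rewrite /F5 (nil_exp qK) //; nia.
  congr (_ + _); apply: eq_fsum => s.
    rewrite /appell1 sg2 mul1r /geo ifT; last by lia.
    rewrite /pw geo_series; last by lia.
    apply: eq_fsum => i; rewrite /F1 /expo1; congr (_ ^+ _); lia.
  rewrite /appell1 sg2 mul1r /geo ifF ?ifT; [|lia|lia].
  rewrite /pw geo_series; last by lia.
  congr (- _); apply: eq_fsum => i; rewrite /F5 /expo1; congr (_ ^+ _); lia.
have b0 : lambert = fsum (fun s => fsum (F1 s)) - fsum (fun s => fsum (F5 s)).
  rewrite /lambert fsum_int; last first.
    apply: (@vanish_fsupp _ (K + 2)) => t tK; apply: (geo0 qK).
    by case: ifP => ?; lia.
  rewrite -fsumN; last exact: fsupp_fst.
  congr (_ + _); apply: eq_fsum => s.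
    rewrite /geo ifT; last by lia.
    rewrite /pw geo_series; last by lia.
    apply: eq_fsum => i; rewrite /F1; congr (_ ^+ _); lia.
  rewrite /geo ifF ?ifT; [|lia|lia].
  rewrite /pw geo_series; last by lia.
  congr (- _); apply: eq_fsum => i; rewrite /F5; congr (_ ^+ _); lia.
have H1 := @fsum_fold F1 F1s.
have H5 : fsum (fun s => fsum (F5 s)) = fsum (fun i => fsum (F5^~ i)).
  exact: fsum_exchange.
have H5' := @fsum_fold (fun i s => F5 s i) (fsupp_swap F5s).
by rewrite /appell_odd a0 a1 b0 H1 H5 H5'; ring.
Qed.

End OddPart2.

(** * The Lambert series as a theta quotient *)

Section Kronecker.
Variables (A : comNzRingType) (K : nat) (p : A).
Hypothesis pK : p ^+ K = 0.
Local Notation sg := (@sg A).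
Local Notation pw := (pw p).
Local Notation geo := (geo K p).

(** sum over k in Z of x^k / (1 - y Q^k) with Q = p^6, x = p^3 and y = p, a series of
Kronecker's type. *)
Definition kronecker : A := fsum (fun k => geo (3 * k) (6 * k + 1)).

(** sum over k of (-1)^k Q^(k(k+1)/2) / (1 - p Q^k) with Q = p^6: the partial
fraction expansion of (Q;Q)^2 / (p, Q/p; Q). *)
Definition kronecker_theta : A := fsum (fun k => sg k * geo (3 * k * k +
  3 * k) (6 * k + 1)).

Definition theta3 (n : int) : A := sg n * pw (3 * (n * n)).

Definition kron_conv (n : int) : A := fsum (fun k => theta3 (n -
  k) * geo (3 * k) (6 * k + 1)).

Lemma sq3_ge0 (x : int) : 0 <= 3 * (x * x).
Proof. by rewrite mulr_ge0 // sqz_ge0. Qed.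

Lemma kron_term0 (k : int) : (K + 2 <= `|k|)%N -> geo (3 * k) (6 * k + 1) = 0.
Proof. by move=> kK; apply: (geo0 pK); case: ifP => ?; lia. Qed.

Lemma kron_fsupp : fsupp (fun k => geo (3 * k) (6 * k + 1)).
Proof. exact: (@vanish_fsupp _ (K + 2) _ kron_term0). Qed.

Lemma kron_mul_fsupp (G : int -> A) : fsupp (fun k => G k * geo (3 * k) (6 * k + 1)).
Proof. exact/fsuppM/kron_fsupp. Qed.

Lemma theta3_vanish (n : int) : (K <= `|n|)%N -> theta3 n = 0.
Proof. by move=> nK; rewrite /theta3 (pw0 pK) ?mulr0 //; nia. Qed.

Lemma theta3_fsupp : fsupp theta3.
Proof. exact: (@vanish_fsupp _ K _ theta3_vanish). Qed.

Lemma kron_geo_ok (k : int) : geo_ok (3 * k) (6 * k + 1).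
Proof. by rewrite /geo_ok; case: ifP => ?; lia. Qed.

(** Clearing the denominators leaves a theta series whose terms are antisymmetric
under a reflection. *)
Lemma kron_conv_rec (n : int) (a b : nat) : a%:Z - b%:Z = 6 * n + 4 ->
  p ^+ b * kron_conv (n + 1) + p ^+ a * kron_conv n = 0.
Proof.
move=> ab; rewrite /kron_conv !fsumMl; try exact: kron_mul_fsupp.
rewrite -fsumD; last 2 first.
- by apply: fsuppM; exact: kron_mul_fsupp.
- by apply: fsuppM; exact: kron_mul_fsupp.
pose E k : int := b%:Z + 3 * ((n + 1 - k) * (n + 1 - k)).
have E0 k : 0 <= E k by rewrite addr_ge0 // mulr_ge0 // sqz_ge0.
have E2 : 0 <= b%:Z + 3 * n + 3 by lia.
have E1 k : `|k|%N%:Z <= E k + 3 * k + `|n|%N%:Z + 4 /\ 0 <= E k + 3 * k.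
  have := E2; rewrite /E; set x := n + 1 - k.
  have -> : k = n + 1 - x by rewrite /x; lia.
  have := sqzS_ge0 (- x); have := sqz_ge0 (`|x|%N%:Z - 1).
  have -> : (`|x|%N%:Z - 1) * (`|x|%N%:Z - 1) = x * x - 2 * `|x|%N%:Z + 1 by nia.
  by rewrite mulrNN; split; lia.
have hE k : p ^+ b * (theta3 (n + 1 - k) * geo (3 * k) (6 * k + 1)) +
    p ^+ a * (theta3 (n - k) * geo (3 * k) (6 * k + 1)) =
      sg (n + 1 - k) * pw (E k + 3 * k).
  rewrite -(pw_nat p b) -(pw_nat p a) /theta3.
  have -> : sg (n + 1 - k) = - sg (n - k) by rewrite -sgS; congr (sg _); lia.
  transitivity (- sg (n - k) * (pw b%:Z * pw (3 * ((n + 1 - k) * (n +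
    1 - k))) * geo (3 * k) (6 * k + 1)
     - pw a%:Z * pw (3 * ((n - k) * (n - k))) * geo (3 * k) (6 * k + 1)));
       first by ring.
  congr (_ * _); rewrite -!pwD ?sq3_ge0 // -/(E k).
  have -> : a%:Z + 3 * ((n - k) * (n - k)) = E k + (6 * k + 1) by rewrite /E; lia.
  have E3 : 0 <= E k + (6 * k + 1).
    have := sqz_ge0 (n - k); rewrite /E; lia.
  rewrite !geoM ?kron_geo_ok ?E0 // [_ + (6 * k + 1) + _]addrAC (geoK pK) //;
    first by lia.
  by have [] := E1 k.
rewrite (eq_fsum hE); apply: (@fsum_odd_refl _ n).
  apply: (@vanish_fsupp _ (K + `|n| + 4)) => k kK.
  by rewrite (pw0 pK) ?mulr0 //; case: (E1 k); lia.
move=> k; have -> : sg (n + 1 - (2 * n + 1 - k)) = - sg (n + 1 - k).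
  by rewrite -sgS; apply: sg_eq; lia.
rewrite mulNr; congr (- (_ * pw _)); rewrite /E; lia.
Qed.

Lemma kron_convE (n : int) : kron_conv n = sg n * pw (3 * n * n + n) * kron_conv 0.
Proof.
pose B (n : int) := sg n * pw (3 * n * n + n).
have B0 : B 0 = 1 by rewrite /B !mulr0 /pw expr0 mulr1.
have Bge (m : int) : 0 <= 3 * m * m + m.
  by have := @jacobi_exp_ge0 3 1 isT m; rewrite mul1r.
have BS (m : int) (a b : nat) : a%:Z - b%:Z = 6 * m + 4 ->
    p ^+ b * B (m + 1) = - (p ^+ a * B m).
  move=> ab; rewrite /B sgS mulNr mulrN !(mulrCA (p ^+ _)); congr (- (_ * _)).
  by rewrite -(pw_nat p b) -(pw_nat p a) -!pwD //; congr pw; lia.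
rewrite -/(B n); case: n => n.
  elim: n => [|n IHn]; first by rewrite B0 mul1r.
  have := @kron_conv_rec n%:Z (6 * n + 4) 0 ltac:(lia).
  have := @BS n%:Z (6 * n + 4)%N 0%N ltac:(lia).
  rewrite expr0 !mul1r; have -> : n%:Z + 1 = n.+1%:Z by lia.
  move=> -> /eqP; rewrite addr_eq0 => /eqP ->.
  by rewrite IHn mulNr mulrA.
suff H m : kron_conv (- m%:Z) = B (- m%:Z) * kron_conv 0 by exact: (H n.+1).
elim: m => [|m IHm]; first by rewrite oppr0 B0 mul1r.
have := @kron_conv_rec (- m.+1%:Z) 0 (6 * m + 2) ltac:(lia).
have := @BS (- m.+1%:Z) 0%N (6 * m + 2)%N ltac:(lia).
rewrite expr0 !mul1r; have -> : - m.+1%:Z + 1 = - m%:Z by lia.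
move=> H /eqP; rewrite addrC addr_eq0 => /eqP ->.
by rewrite IHm mulrA H mulNr opprK.
Qed.

Lemma kron_conv0 : kron_conv 0 = kronecker_theta.
Proof.
apply: eq_fsum => k; rewrite /theta3 sub0r sgN mulrNN -mulrA; congr (_ * _).
rewrite geoM ?kron_geo_ok ?sq3_ge0 //; congr geo; lia.
Qed.

(** The coefficients of theta times the Kronecker series are determined by the one of
index 0 ([kron_convE]); summing them gives the pentagonal series. *)
Lemma kronecker_eta : fsum theta3 * kronecker = eta p * kronecker_theta.
Proof.
pose F (n k : int) := theta3 (n - k) * geo (3 * k) (6 * k + 1).
have Fs : fsupp (fun x : int * int => F x.1 x.2).
  apply: (@vanish_fsupp2 _ (2 * K + 2)) => n k nk; rewrite /F.
  have [kK|kK] := leqP (K + 2) `|k|; first by rewrite kron_term0 ?mulr0.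
  by rewrite theta3_vanish ?mul0r //; lia.
have -> : eta p * kronecker_theta = fsum (fun n => fsum (F n)).
  rewrite /eta fsumMr; last first.
    by apply: (@vanish_fsupp _ K) => j; exact: jacobi_term0.
  apply: eq_fsum => n; by rewrite -kron_conv0 -[RHS]/(kron_conv n) [RHS]kron_convE
    /jacobi_term mul1r.
rewrite (fsum_exchange Fs).
rewrite /kronecker fsumMl; last exact: kron_fsupp.
apply: eq_fsum => k; rewrite fsumMr; last exact: theta3_fsupp.
rewrite [RHS](fsum_shift k); apply: eq_fsum => n.
by rewrite /F addrK.
Qed.

Local Notation iqfacz := (iqfacz K p 3).

(** Finite form of [kronecker_theta]. *)
Definition kron_fin (n : nat) : A := fsum (fun k =>
  sg k * geo (3 * k * k + 3 * k) (6 * k + 1) * (iqfacz (n%:Z - k) * iqfacz (n%:Z + k))).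

Let P6 : (p ^+ 6) ^+ K = 0.
Proof. by rewrite -exprM mulnC exprM pK expr0n. Qed.

Lemma iqfacz6_fsupp (G : int -> A) (n : int) : fsupp (fun k =>
  G k * (iqfacz (n - k) * iqfacz (n + k))).
Proof. exact: (@iqfacz_fsupp A K p 3 1 isT). Qed.

(** [finite_theta] in base p^6, unfolded to a sum over int. *)
Lemma finite_theta_int (N : nat) : (0 < N)%N ->
  fsum (fun k => sg k * pw (3 * k * k + 3 * k) * (iqfacz (N%:Z - k) * iqfacz (N%:Z +
    k))) = 0.
Proof.
move=> N0; rewrite fsum_int; last exact: iqfacz6_fsupp.
have s1 : fsupp (fun n : nat => sg n * pw (3 * n%:Z * n + 3 * n%:Z) *
    (iqfacz (N%:Z - n%:Z) * iqfacz (N%:Z + n%:Z))).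
  apply: (@fsupp_nat _ K) => n nK; rewrite (pw0 pK) ?mulr0 ?mul0r //; nia.
rewrite fsum_recl // -addrA -fsumD; last 2 first.
- apply: (@fsupp_nat _ K) => n nK; rewrite (pw0 pK) ?mulr0 ?mul0r //; nia.
- apply: (@fsupp_nat _ K) => n nK; rewrite (pw0 pK) ?mulr0 ?mul0r //; nia.
rewrite -(finite_theta P6 N0) (@fsum_nat _ N) => [|n nN]; last first.
  have -> : N%:Z - n.+1%:Z = Negz (n - N) by lia.
  by rewrite /= !(mul0r, mulr0) addr0.
congr (_ + _).
  have -> : N%:Z - 0%N%:Z = N%:Z by lia.
  have -> : pw (3 * 0%N%:Z * 0%N%:Z + 3 * 0%N%:Z) = 1 by rewrite /pw (_ : absz _ =
    0%N) ?expr0.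
  by rewrite sg0 !mul1r.
apply: eq_bigr => r _; have rN := ltn_ord r.
have -> : N%:Z - r.+1%:Z = (N - r.+1)%N%:Z by lia.
have -> : N%:Z - - r.+1%:Z = (N + r.+1)%N%:Z by lia.
rewrite sgN /= sg_nat -!exprM.
have t2 : (tri r * 2 = r * r.+1)%N.
  by elim: (nat_of_ord r) => [|m]; rewrite ?tri0 ?triS //; lia.
have -> : p ^+ (6 * tri r) = pw (3 * - r.+1%:Z * - r.+1%:Z + 3 * - r.+1%:Z).
  by rewrite -pw_nat; congr pw; nia.
have -> : pw (3 * r.+1%:Z * r.+1%:Z + 3 * r.+1%:Z) =
    pw (3 * - r.+1%:Z * - r.+1%:Z + 3 * - r.+1%:Z) * p ^+ (6 * r.+1).
  by rewrite -pw_nat -pwD //; [congr pw; lia | nia].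
by ring.
Qed.

Lemma kron_expo_ge0 (k : int) : 0 <= 3 * k * k + 3 * k.
Proof. by have := sqzS_ge0 k; lia. Qed.

Lemma kron_expo_opp_ge0 (k : int) : 0 <= 3 * k * k - 3 * k.
Proof. by have := sqzS_ge0 (- k); rewrite mulrNN; lia. Qed.

(** With Q = p^6 and N = n + 1, the difference of (1 - Q^(N-k)) (1 - Q^(N+k)) and
(1 - p Q^N) (1 - Q^N / p) is (Q^N / p) (1 - p Q^k) (1 - p Q^(-k)): the first factor
cancels the denominator, and the second leaves two multiples of
[finite_theta_int]. *)
Lemma kron_finS n : kron_fin n = (1 - p ^+ (6 * n + 7)) * (1 - p ^+ (6 * n +
  5)) * kron_fin n.+1.
Proof.
set N := n.+1.
pose b k := iqfacz (N%:Z - k) * iqfacz (N%:Z + k).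
pose e (k : int) := 3 * k * k + 3 * k.
pose v (k : int) := 6 * k + 1.
have bs G : fsupp (fun k => G k * b k) by exact: iqfacz6_fsupp.
have E0 : kron_fin n = fsum (fun k => sg k * geo (e k) (v k) *
    ((1 - pw (6 * (N%:Z - k))) * (1 - pw (6 * (N%:Z + k)))) * b k).
  apply: eq_fsum => k; rewrite /b.
  have -> : n%:Z - k = N%:Z - k - 1 by rewrite /N; lia.
  have -> : n%:Z + k = N%:Z + k - 1 by rewrite /N; lia.
  by rewrite !(@iqfaczS _ _ _ pK 3 1 isT) -/(e k) -/(v k) (_ : 2 * 3 = 6) //; ring.
(* the two sums left over once the denominators are cancelled *)
have Z1 : fsum (fun k => p ^+ (6 * n + 5) * (sg k * pw (e k)) * b k) = 0.
  under eq_fsum do rewrite -mulrA.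
  by rewrite -fsumMl ?(finite_theta_int (ltn0Sn n)) ?mulr0 //; exact: bs.
have Z2 : fsum (fun k => p ^+ (6 * n + 6) * (sg k * pw (3 * k * k - 3 * k)) * b k) = 0.
  under eq_fsum do rewrite -mulrA.
  rewrite -fsumMl; last exact: bs.
  rewrite (fsum_refl 0) -[RHS](mulr0 (p ^+ (6 * n + 6))); congr (_ * _).
  rewrite -(finite_theta_int (ltn0Sn n)); apply: eq_fsum => k.
  have -> : 3 * (0 - k) * (0 - k) - 3 * (0 - k) = e k by rewrite /e; lia.
  have -> : sg (0 - k) = sg k by rewrite sub0r sgN.
  rewrite /b; have -> : N%:Z - (0 - k) = N%:Z + k by lia.
  have -> : N%:Z + (0 - k) = N%:Z - k by lia.
  by rewrite [iqfacz _ * iqfacz _]mulrC.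
rewrite E0 -[RHS]addr0 -Z1 -[RHS]subr0 -Z2 /kron_fin fsumMl; last exact: bs.
rewrite -fsumD; [|exact/fsuppM/bs|exact: bs].
rewrite -fsumB; [|apply: fsuppD; [exact/fsuppM/bs|exact: bs]|exact: bs].
apply: eq_fsum => k; rewrite -/(b k) -/(e k) -/(v k).
have [kN|kN] := leqP `|k|%N N; last first.
  suff -> : b k = 0 by rewrite !mulr0 addr0 subr0.
  rewrite /b; have [H|H] : (N%:Z - k < 0) \/ (N%:Z + k < 0) by lia.
    by case: (N%:Z - k) H => // m _; rewrite /= mul0r.
  by case: (N%:Z + k) H => // m _; rewrite /= mulr0.
have ek : 0 <= e k by exact: kron_expo_ge0.
have ok : geo_ok (e k) (v k).
  rewrite /geo_ok; case: ifP => // H; move: H ek; rewrite /v; lia.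
have c1 : pw (6 * (N%:Z - k)) * pw (6 * (N%:Z + k)) =
  p ^+ (6 * n + 7) * p ^+ (6 * n + 5).
  rewrite -exprD -pwD; [|lia|lia].
  by rewrite -(pw_nat p (_ + _)%N); congr pw; rewrite /N; lia.
have g1 : p ^+ (6 * n + 5) * geo (e k) (v k) - pw (6 * (N%:Z + k)) * geo (e k) (v k)
    = p ^+ (6 * n + 5) * pw (e k).
  rewrite -!(pw_nat p (6 * n + 5)) !geoM //; last by lia.
  rewrite -pwD // -(@geoK _ _ _ pK _ (v k)); [|by rewrite /v; lia|by rewrite addr_ge0].
  by congr (_ - geo _ _); rewrite /v /N; lia.
have g2 : pw (6 * (N%:Z - k)) * geo (e k) (v k) - p ^+ (6 * n + 7) * geo (e k) (v k)
    = p ^+ (6 * n + 6) * pw (3 * k * k - 3 * k).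
  rewrite -(pw_nat p (6 * n + 7)) -(pw_nat p (6 * n + 6)) !geoM //; last by lia.
  rewrite -pwD ?kron_expo_opp_ge0 // (_ : (6 * n + 6)%N%:Z + (3 * k * k - 3 * k) =
    6 * (N%:Z - k) + e k).
    rewrite -(@geoK _ _ _ pK (6 * (N%:Z - k) + e k) (v k)); [|by rewrite /v; lia|].
      by congr (_ - geo _ _); rewrite /v /N; lia.
    by rewrite addr_ge0 // mulr_ge0 //; lia.
  by rewrite /e /N; lia.
transitivity (((1 - p ^+ (6 * n + 7)) * (1 - p ^+ (6 * n +
  5)) * (sg k * geo (e k) (v k)) +
    sg k * ((p ^+ (6 * n + 5) * geo (e k) (v k) - pw (6 * (N%:Z +
      k)) * geo (e k) (v k)) -
    (pw (6 * (N%:Z - k)) * geo (e k) (v k) - p ^+ (6 * n +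
      7) * geo (e k) (v k)))) * b k).
  have -> : (1 - pw (6 * (N%:Z - k))) * (1 - pw (6 * (N%:Z + k))) =
    1 - pw (6 * (N%:Z - k)) - pw (6 * (N%:Z + k)) + p ^+ (6 * n + 7) * p ^+ (6 * n + 5).
    by rewrite -c1; ring.
  by ring.
by rewrite g1 g2; ring.
Qed.

(** Partial fractions of 1 / ((p;p^6)_(n+1) (p^5;p^6)_n). *)
Lemma kron_finP n : (\prod_(i < n) ((1 - p ^+ (6 * i + 1)) * (1 - p ^+ (6 * i + 5)))) *
  (1 - p ^+ (6 * n + 1)) * kron_fin n = 1.
Proof.
elim: n => [|n IHn].
  rewrite big_ord0 mul1r /kron_fin (@fsumE _ _ [:: 0 : int]) ?big_seq1 //; last first.
    move=> k; rewrite inE => k0.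
    have [H|H] : (0 - k < 0) \/ (0 + k < 0) by move: k0; lia.
      by case: (0 - k) H => // m _; rewrite /= mul0r mulr0.
    by case: (0 + k) H => // m _; rewrite /= !mulr0.
  rewrite /= iqfac0 !mulr1 sg0 mul1r /geo !mulr0 !add0r /= /pw expr0 mul1r.
  by rewrite muln0 (ginvP pK).
rewrite big_ord_recr /= -[RHS]IHn (kron_finS n).
have -> : (6 * n.+1 + 1 = 6 * n + 7)%N by lia.
by ring.
Qed.

Lemma kronecker_thetaP : qprod K p 1 6 * qprod K p 5 6 * kronecker_theta =
  qprod K p 6 6 * qprod K p 6 6.
Proof.
have kapp0 (k : int) : (K + 2 <= `|k|)%N -> geo (3 * k * k + 3 * k) (6 * k + 1) = 0.
  move=> kK; apply: (geo0 pK); have := sqz_ge0 (`|k|%N%:Z - 1).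
  have -> : (`|k|%N%:Z - 1) * (`|k|%N%:Z - 1) = k * k - 2 * `|k|%N%:Z + 1 by nia.
  by case: ifP => ?; lia.
have f6 : qfac (p ^+ 6) K = qprod K p 6 6.
  by apply: eq_bigr => i _; rewrite -exprM; congr (1 - _ ^+ _); lia.
have lim : kron_fin (2 * (K + 2)) = kronecker_theta * (iqfac K (p ^+ 6) K *
  iqfac K (p ^+ 6) K).
  rewrite /kronecker_theta fsumMr; last first.
    by apply: (@vanish_fsupp _ (K + 2)) => k kK; rewrite kapp0 ?mulr0.
  apply: eq_fsum => k; have [kK|kK] := ltnP `|k|%N (K + 2); last first.
    by rewrite kapp0 // mulr0 !mul0r.
  congr (_ * _).
  have -> : (2 * (K + 2))%N%:Z - k = (absz ((2 * (K + 2))%N%:Z - k))%:Z by lia.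
  have -> : (2 * (K + 2))%N%:Z + k = (absz ((2 * (K + 2))%N%:Z + k))%:Z by lia.
  by rewrite /= !(iqfac_stable P6) //; lia.
have := kron_finP (2 * (K + 2)); rewrite lim big_split /= !(qprod_stable pK) //;
  try by lia.
rewrite (nil_exp pK) ?subr0 ?mulr1; last by lia.
have u : qprod K p 6 6 * iqfac K (p ^+ 6) K = 1 by rewrite -f6 (qfacK P6).
move=> E; transitivity (qprod K p 1 6 * qprod K p 5 6 * (kronecker_theta *
   (iqfac K (p ^+ 6) K * iqfac K (p ^+ 6) K)) * (qprod K p 6 6 * qprod K p 6 6)).
  transitivity (qprod K p 1 6 * qprod K p 5 6 * kronecker_theta * (qprod K p 6 6 *
    iqfac K (p ^+ 6) K)
   * (qprod K p 6 6 * iqfac K (p ^+ 6) K)); last by ring.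
  by rewrite u !mulr1.
by rewrite E mul1r.
Qed.

End Kronecker.

(** * Product formulas, coloured partitions and coefficients *)

Section SigmaOddProduct.
Variables (A : comNzRingType) (K : nat) (q : A).
Hypothesis qK : q ^+ K = 0.
Let p := q ^+ 2.
Let pK : p ^+ K = 0.
Proof. by rewrite /p -exprM mulnC exprM qK expr0n. Qed.

Lemma ginv_sqr v : ginv K p v = ginv K q (2 * v).
Proof. by apply: eq_bigr => i _; rewrite /p -exprM; congr (_ ^+ _); lia. Qed.

Lemma pw_sqr e : pw p e = pw q (2 * e).
Proof. by rewrite /pw /p -exprM; congr (_ ^+ _); lia. Qed.

Lemma geo_sqr e v : geo K p e v = geo K q (2 * e) (2 * v).
Proof.
rewrite /geo !pw_sqr ginv_sqr mulrBr (_ : absz (2 * v) = (2 * absz v)%N); last by lia.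
have -> : (0 < 2 * v) = (0 < v) by lia.
have -> : (2 * v < 0) = (v < 0) by lia.
by [].
Qed.

Lemma lambert_kronecker : lambert K q = q * kronecker K p.
Proof.
rewrite /lambert /kronecker fsumMl; last exact: kron_fsupp.
apply: eq_fsum => k; rewrite geo_sqr -[q](pw_nat q 1) geoM //.
  by congr geo; lia.
by rewrite /geo_ok; case: ifP => ?; lia.
Qed.

Lemma eta_prod (r : A) : r ^+ K = 0 ->
  eta r = qprod K r 6 6 * qprod K r 4 6 * qprod K r 2 6.
Proof. by move=> rK; rewrite /eta (@jacobi_triple _ _ _ rK 3 1). Qed.

(** Gauss's product for sum_n (-1)^n p^(3 n^2). *)
Lemma theta3_prod : fsum (theta3 p) = qprod K p 6 6 * qprod K p 3 6 * qprod K p 3 6.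
Proof.
have p3K : (p ^+ 3) ^+ K = 0 by rewrite -exprM mulnC exprM pK expr0n.
have E a b : qprod K (p ^+ 3) a b = qprod K p (3 * a) (3 * b).
  by apply: eq_bigr => i _; rewrite -exprM; congr (1 - _ ^+ _); lia.
rewrite -!(E 2 2) -!(E 1 2) -(@jacobi_triple _ _ _ p3K 1 0) //.
apply: eq_fsum => n; rewrite /theta3 /jacobi_term; congr (_ * _).
by rewrite /pw -exprM; congr (_ ^+ _); lia.
Qed.

(** Everything is now a product in base p^6; the powers of the factors with
residues 2, 4 and 6 that occur on both sides are units. *)
Lemma sigma_odd_prod :
  (sigma_at K q - sigma_at K (- q)) *
    ((qprod K p 1 6) ^+ 2 * (qprod K p 3 6) ^+ 3 * (qprod K p 5 6) ^+ 2) =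
  2 * q * qprod K p 6 6.
Proof.
have e1 := sigma_odd qK; rewrite (appell_odd_lambert qK) lambert_kronecker in e1.
have e2 := kronecker_eta pK; rewrite theta3_prod (eta_prod pK) in e2.
have e3 := kronecker_thetaP pK.
have eq1 : eta q = \prod_(c < 6) qprod K p c.+1 6.
  rewrite (eta_prod qK).
  have E a b : qprod K p a b = qprod K q (2 * a) (2 * b).
    by apply: eq_bigr => i _; rewrite /p -exprM; congr (1 - _ ^+ _); lia.
  transitivity (qprod K q 2 2).
    rewrite (@qprod_split _ _ _ qK 3 2 2) // !big_ord_recr big_ord0 /= mul1r.
    by rewrite mulrC [qprod K q 6 6 * _]mulrC mulrA.
  rewrite (@qprod_split _ _ _ qK 6 2 2) //; apply: eq_bigr => c _.
  by rewrite E; congr qprod; lia.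
rewrite eq1 !big_ord_recr big_ord0 /= mul1r in e1.
have [v2 u2] := @qprod_unit _ _ _ pK 2 6 isT.
have [v4 u4] := @qprod_unit _ _ _ pK 4 6 isT.
have [v6 u6] := @qprod_unit _ _ _ pK 6 6 isT.
move: e1 e2 e3 u2 u4 u6.
set s := sigma_at K q - _; set k := kronecker K p; set t := kronecker_theta K p.
set a1 := qprod K p 1 6; set a2 := qprod K p 2 6; set a3 := qprod K p 3 6.
set a4 := qprod K p 4 6; set a5 := qprod K p 5 6; set a6 := qprod K p 6 6.
move=> e1 e2 e3 u2 u4 u6.
apply: (unit_cancel u2); apply: (unit_cancel u4); apply: (unit_cancel u6).
apply: (unit_cancel u6).
transitivity (a1 * a2 * a3 * a4 * a5 * a6 * s * (a6 * a3 * a3 * a1 * a5));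
  first by ring.
rewrite e1; transitivity (2 * q * (a6 * a3 * a3 * k) * (a1 * a5)); first by ring.
rewrite e2; transitivity (2 * q * (a6 * a4 * a2) * (a1 * a5 * t)); first by ring.
by rewrite e3; ring.
Qed.

End SigmaOddProduct.

Section Evaluation.
Variables (A : comNzRingType) (K : nat) (q : A).
Hypothesis qK : q ^+ K = 0.

(** The value of an integral power series at a nilpotent element. *)
Definition fps_eval (f : fps int) : A := fsum (fun i => (f i)%:~R * q ^+ i).

Lemma fps_eval_supp (f : fps int) : fsupp (fun i => (f i)%:~R * q ^+ i).
Proof. by apply: (@fsupp_nat _ K) => i iK; rewrite (nil_exp qK) ?mulr0. Qed.

Lemma eq_fps_eval f g : f =1 g -> fps_eval f = fps_eval g.
Proof. by move=> fg; apply: eq_fsum => i; rewrite fg. Qed.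

Lemma fps_evalM f g : fps_eval (fps_mul f g) = fps_eval f * fps_eval g.
Proof.
pose F N i := if (i <= N)%N then (f i)%:~R * q ^+ i *
  ((g (N - i)%N)%:~R * q ^+ (N - i)) else 0.
have Fs : fsupp (fun x : nat * nat => F x.1 x.2).
  apply: (@fsupp_nat2 _ K) => N i Ni; rewrite /F; case: ifP => // iN.
  by rewrite mulrACA -exprD subnKC // (nil_exp qK) ?mulr0 //; lia.
transitivity (fsum (fun N => fsum (F N))).
  apply: eq_fsum => N; rewrite (@fsum_nat _ N.+1) => [|i Ni]; last first.
    by rewrite /F leqNgt Ni.
  rewrite rmorph_sum mulr_suml; apply: eq_bigr => i _ /=.
  by rewrite /F -ltnS ltn_ord rmorphM mulrACA -exprD subnKC // -ltnS.
rewrite (fsum_exchange Fs) /fps_eval fsumMr; last exact: fps_eval_supp.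
apply: eq_fsum => i; rewrite fsumMl; last exact: fps_eval_supp.
by rewrite -[RHS](fsum_nat_shift i).
Qed.

Lemma fps_eval_poly (P : {poly int}) : fps_eval (fps_of_poly P) = (map_poly intr P).[q].
Proof.
rewrite /fps_eval (@fsum_nat _ (size P)) => [|i iP]; last first.
  by rewrite /fps_of_poly nth_default // mul0r.
rewrite (@horner_coef_wide _ (size P)) ?size_poly //.
by apply: eq_bigr => i _; rewrite coef_map.
Qed.

Lemma horner_qpoch (b r : {poly int}) n (b' r' : A) :
  (map_poly intr b).[q] = b' -> (map_poly intr r).[q] = r' ->
  (map_poly intr (qpoch b r n)).[q] = \prod_(k < n) (1 - b' * r' ^+ k).
Proof.
move=> <- <-; rewrite /qpoch rmorph_prod horner_prod.
by apply: eq_bigr => k _; rewrite rmorphB rmorph1 rmorphM rmorphXn /= !hornerE.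
Qed.

Lemma eval_sigma_term n :
  fps_eval (sigma_term n) = q ^+ tri n.+1 * qfac_opp q n * bailey_sum K q n.
Proof.
have /eq_fps_eval := sigma_termK n; rewrite fps_evalM !fps_eval_poly.
rewrite (@horner_qpoch _ _ n.+1 q (q ^+ 2)); last 2 first.
- by rewrite map_polyX hornerX.
- by rewrite map_polyXn hornerXn.
rewrite rmorphM /= hornerM map_polyXn hornerXn.
rewrite (@horner_qpoch _ _ n (- q) q); last 2 first.
- by rewrite rmorphN /= map_polyX hornerN hornerX.
- by rewrite map_polyX hornerX.
have -> : \prod_(k < n) (1 - - q * q ^+ k) = qfac_opp q n.
  by apply: eq_bigr => k _; rewrite mulNr opprK -exprS.
have -> : \prod_(k < n.+1) (1 - q * (q ^+ 2) ^+ k) = oddfac q n.+1.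
  by apply: eq_bigr => k _; rewrite -exprM -exprS addn1.
have -> : ((n.+1 * n.+2) %/ 2 = tri n.+1)%N.
  by rewrite triE bin2 -divn2 mulnC.
move=> E; rewrite -E -mulrA [_ * bailey_sum K q n]mulrC.
by rewrite [bailey_sum K q n * _]mulrC (bailey_sumP qK) mulr1.
Qed.

(** Only coefficients below K matter, and a common bound makes their partial sums
equal to those of the limit. *)
Lemma eval_sigma (P : fps int) : fps_has_sum sigma_term P -> fps_eval P = sigma_at K q.
Proof.
move=> PS; have [M [KM PE]] : exists M, (K <= M)%N /\
    forall i, (i < K)%N -> P i = \sum_(n < M) sigma_term n i.
  suff [M PE] : exists M, forall i m, (i < K)%N -> (M <= m)%N ->
      P i = \sum_(n < m) sigma_term n i.
    exists (maxn K M); split; first exact: leq_maxl.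
    by move=> i iK; apply: PE => //; exact: leq_maxr.
  elim: (K) => [|k [M PE]]; first by exists 0%N.
  have [M' PM'] := PS k; exists (maxn M M') => i m ik; rewrite geq_max => /andP[Mm M'm].
  move: ik; rewrite ltnS leq_eqVlt => /predU1P[->|ik]; first by rewrite PM'.
  exact: PE.
rewrite /fps_eval (@fsum_nat _ K) => [|i iK]; last by rewrite (nil_exp qK) ?mulr0.
under eq_bigr => i _ do rewrite PE ?ltn_ord // rmorph_sum mulr_suml.
rewrite exchange_big /= /sigma_at (@fsum_nat _ M) => [|n nM]; last first.
  by rewrite (nil_exp qK) ?mul0r //; apply: leq_trans (tri_ge _); lia.
apply: eq_bigr => n _; rewrite -eval_sigma_term /fps_eval (@fsum_nat _ K) // => i iK.
by rewrite (nil_exp qK) ?mulr0.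
Qed.

Lemma fps_eval_trunc (f : fps int) : fps_eval f = (map_poly intr (\poly_(i < K) f
  i)).[q].
Proof.
rewrite -fps_eval_poly; apply: eq_fsum => i; rewrite /fps_of_poly coef_poly.
by case: ltnP => // iK; rewrite (nil_exp qK) ?mulr0.
Qed.

End Evaluation.

Section Partitions.
Variable n : nat.
Local Notation part := ('I_n * 'I_3)%type.

Definition part_ok (x : part) (k : nat) : bool :=
  ((0 < k)%N ==> (x.2 < nb_colours x.1.+1)%N) && ((6 %| x.1.+1)%N ==> (k <= 1)%N).

Definition part_wt (x : part) (k : nat) : int :=
  if part_ok x k then (if (6 %| x.1.+1)%N then (-1) ^+ k else 1) else 0.

(** Polynomial whose coefficient of degree n counts the coloured partitions with the
sign given by the number of parts divisible by 6; multiplicities range up to n. *)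
Definition part_gf : {poly int} :=
  \prod_(x : part) \sum_(k < n.+1) part_wt x k *: 'X^(k * x.1.+1).

(** Expanding the product over (part, colour) yields one term per choice of
multiplicities. *)
Lemma part_gf_coef : part_gf`_n = (P_sigma_de n)%:Z - (P_sigma_do n)%:Z.
Proof.
rewrite /part_gf bigA_distr_bigA /= coef_sum.
have wt (m : coloured_parts n) : (\prod_x (part_wt x (m x) *: 'X^(m x *
  x.1.+1)) : {poly int})`_n
    = if sigma_partition m then (-1) ^+ nb_parts0mod6 m else 0.
  rewrite scaler_prod prodrXr coefZ coefXn.
  have -> : (n == \sum_x m x * x.1.+1)%N = (\sum_x m x *
    x.1.+1 == n)%N by rewrite eq_sym.
  rewrite /sigma_partition; case: eqP => _ /=; last by rewrite mulr0.
  rewrite mulr1; case: ifP => [/andP[/forallP h1 /forallP h2]|].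
    rewrite /nb_parts0mod6 -prodrXr [RHS]big_mkcond /=; apply: eq_bigr => x _.
    by rewrite /part_wt /part_ok h1 h2.
  move=> /negbT; rewrite negb_and => /orP[] /forallPn[x hx]; rewrite (bigD1 x) //=.
    by rewrite /part_wt /part_ok (negPf hx) mul0r.
  by rewrite /part_wt /part_ok (negPf hx) andbF mul0r.
rewrite (eq_bigr _ (fun m _ => wt m)) -big_mkcond /=.
rewrite (bigID (fun m : coloured_parts n => odd (nb_parts0mod6 m))) /= addrC.
congr (_ + _).
  rewrite (eq_bigr (fun=> 1)) => [|m /andP[_ /negPf h]]; last by rewrite -signr_odd h.
  rewrite sumr_const /P_sigma_de -natz; congr (_ *+ _).
  by apply: eq_card => m; rewrite !inE.
rewrite (eq_bigr (fun=> -1)) => [|m /andP[_ h]]; last by rewrite -signr_odd h.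
rewrite sumr_const /P_sigma_do mulNrn -natz; congr (- (_ *+ _)).
by apply: eq_card => m; rewrite !inE.
Qed.

End Partitions.

Section PartitionProduct.
Variables (A : comNzRingType) (K : nat) (p : A) (n : nat).
Hypotheses (pK : p ^+ K = 0) (pn : p ^+ n.+1 = 0).

(** Factor of 1/C(p) contributed by the parts of size s that may be repeated. *)
Definition denom (s : nat) : A :=
  if (6 %| s)%N then 1 else (1 - p ^+ s) ^+ nb_colours s.
Definition numer (s : nat) : A := if (6 %| s)%N then 1 - p ^+ s else 1.

(** A repeatable part contributes a geometric sum up to multiplicity n, which inverts
1 - p^s because p^(n+1) = 0. *)
Lemma part_factor (i : 'I_n) :
  (\prod_(c < 3) \sum_(k < n.+1) (part_wt (i, c) k)%:~R * p ^+ (k * i.+1)) * denom i.+1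
  = numer i.+1.
Proof.
set s := i.+1; have s0 : (0 < s)%N by [].
have n0 : (0 < n)%N by apply: leq_ltn_trans (ltn_ord i).
pose L (c : 'I_3) : A := \sum_(k < n.+1) (part_wt (i, c) k)%:~R * p ^+ (k * i.+1).
have L0 (c : 'I_3) : (nb_colours s <= c)%N -> L c = 1.
  move=> cs; rewrite /L big_ord_recl big1 => [|k _].
    rewrite /part_wt /part_ok /= implybT mul0n addr0.
    by rewrite ?expr0 if_same mulr1.
  by rewrite /part_wt /part_ok /= ltnNge cs mul0r.
have L6 (c : 'I_3) : (6 %| s)%N -> (c < nb_colours s)%N -> L c = 1 - p ^+ s.
  move=> s6 cs; rewrite /L big_ord_recl (bigD1 (Ordinal n0)) //= big1 => [|k k0].
    rewrite /part_wt /part_ok /= -/s s6 cs /bump /= mul0n mul1n ?expr0 ?expr1.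
    by rewrite addr0 mulr1 mulN1r.
  have {}k0 : (0 < k)%N by rewrite lt0n; apply: contra k0 => /eqP k0; apply/eqP/val_inj.
  by rewrite /part_wt /part_ok /= -/s s6 cs /bump /= leqNgt ltnS k0 /= mul0r.
have L1 (c : 'I_3) : ~~ (6 %| s)%N -> (c < nb_colours s)%N -> L c * (1 - p ^+ s) = 1.
  move=> s6 cs.
  have -> : L c = \sum_(k < n.+1) (p ^+ s) ^+ k.
    apply: eq_bigr => k _; rewrite /part_wt /part_ok /= -/s (negPf s6) cs implybT.
    by rewrite mul1r mulnC exprM.
  rewrite mulrC -[1 - _]opprB mulNr -subrX1 opprB -exprM mulnC exprM pn expr0n.
  by rewrite eqn0Ngt s0 subr0.
rewrite -[X in X * _]/(\prod_(c < 3) L c) !big_ord_recr big_ord0 /= mul1r.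
set c0 := widen_ord _ (widen_ord _ _); set c1 := widen_ord _ _; set c2 := ord_max.
rewrite /denom /numer; move: L0 L1 L6; rewrite /nb_colours /dvdn.
set d := 1 - p ^+ s; clearbody d L.
case: (s %% 6)%N => [|[|[|[|[|[|r]]]]]] /= L0 L1 L6.
- by rewrite (L6 c0) // (L0 c1) // (L0 c2) // !mulr1.
- rewrite (L0 c2) //; transitivity (L c0 * d * (L c1 * d)); first by ring.
  by rewrite !L1 // mulr1.
- by rewrite (L0 c0) // (L0 c1) // (L0 c2) // expr0 !mulr1.
- transitivity (L c0 * d * (L c1 * d) * (L c2 * d)); first by ring.
  by rewrite !L1 // !mulr1.
- by rewrite (L0 c0) // (L0 c1) // (L0 c2) // expr0 !mulr1.
- rewrite (L0 c2) //; transitivity (L c0 * d * (L c1 * d)); first by ring.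
  by rewrite !L1 // mulr1.
- by rewrite (L0 c0) // (L0 c1) // (L0 c2) // expr0 !mulr1.
Qed.

Definition part_eval : A := (map_poly intr (part_gf n)).[p].

Lemma part_evalE : part_eval = \prod_(i < n) \prod_(c < 3) \sum_(k < n.+1)
    (part_wt (i, c) k)%:~R * p ^+ (k * i.+1).
Proof.
rewrite /part_eval /part_gf rmorph_prod horner_prod pair_big /=.
apply: eq_bigr => -[i c] _ /=; rewrite rmorph_sum /= horner_sum.
by apply: eq_bigr => k _; rewrite map_polyZ map_polyXn hornerZ hornerXn.
Qed.

Lemma part_eval_prod M : (n <= M)%N ->
  part_eval * \prod_(i < M) denom i.+1 = \prod_(i < M) numer i.+1.
Proof.
elim: M => [|M IHM].
  rewrite leqn0 => /eqP n0; rewrite !big_ord0 mulr1 part_evalE.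
  by rewrite big1 // => i; have := ltn_ord i; rewrite {2}n0.
rewrite leq_eqVlt => /predU1P[<-|nM]; last first.
  rewrite !big_ord_recr /= mulrA IHM //.
  have pM : p ^+ M.+1 = 0 by apply: (nil_exp pn).
  rewrite /denom /numer pM subr0 expr1n !if_same //.
by rewrite part_evalE -big_split; apply: eq_bigr => i _; rewrite /= part_factor.
Qed.

Lemma residue i k : (k < 5)%N -> ((i * 6 + k).+1 %% 6 = k.+1)%N.
Proof. lia. Qed.

Lemma residue5 i : ((i * 6 + 5).+1 %% 6 = 0)%N.
Proof. lia. Qed.

Lemma part_eval_qprod : (0 < K)%N -> (n <= 6 * K)%N ->
  part_eval * ((qprod K p 1 6) ^+ 2 * (qprod K p 3 6) ^+ 3 * (qprod K p 5 6) ^+ 2)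
  = qprod K p 6 6.
Proof.
move=> K0 nK; have := part_eval_prod nK; rewrite mulnC.
rewrite (big_ord_mul (fun i => denom i.+1)) (big_ord_mul (fun i => numer i.+1)).
have nE : \prod_(i < K) \prod_(c < 6) numer (i * 6 + c).+1 = qprod K p 6 6.
  apply: eq_bigr => i _; rewrite !big_ord_recr big_ord0 /= /numer /dvdn.
  by rewrite residue5 !residue //= !mul1r; congr (1 - p ^+ _); lia.
have dE : \prod_(i < K) \prod_(c < 6) denom (i * 6 + c).+1 =
  (qprod K p 1 6) ^+ 2 * (qprod K p 3 6) ^+ 3 * (qprod K p 5 6) ^+ 2.
  rewrite /qprod -!prodrXl -!big_split; apply: eq_bigr => i _ /=.
  rewrite !big_ord_recr big_ord0 /= /denom /dvdn /nb_colours.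
  rewrite residue5 !residue //= !expr0 !mulr1 !mul1r.
  have -> : ((i * 6 + 0).+1 = 6 * i + 1)%N by lia.
  have -> : ((i * 6 + 2).+1 = 6 * i + 3)%N by lia.
  by have -> : ((i * 6 + 4).+1 = 6 * i + 5)%N by lia.
by rewrite nE dE.
Qed.
End PartitionProduct.

Section TruncatedPolynomials.
Variable K : nat.
Local Notation R := {poly %/ ('X^(K.+1) : {poly int})}.

(** Congruence modulo X^(K+1) preserves the coefficients of degree at most K. *)
Lemma in_qpoly_coef (P Q : {poly int}) i : (i < K.+1)%N ->
  in_qpoly 'X^(K.+1) P = in_qpoly 'X^(K.+1) Q -> P`_i = Q`_i.
Proof.
move=> iK /(congr1 (fun x : R => (polyn x)`_i)) /=.
by rewrite mk_monic_Xn /= -!Pdiv.RingMonic.take_poly_rmodp !coef_take_poly iK.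
Qed.

Lemma qpoly_nilX : (in_qpoly 'X^(K.+1) 'X : R) ^+ K.+1 = 0.
Proof.
rewrite -rmorphXn; apply/val_inj => /=.
by rewrite mk_monic_Xn /= -Pdiv.RingMonic.take_poly_rmodp; apply/polyP => i;
  rewrite coef_take_poly coefXn coef0; case: ltngtP.
Qed.

Lemma horner_qpoly (P Q : {poly int}) :
  (map_poly intr P).[in_qpoly 'X^(K.+1) Q] = in_qpoly 'X^(K.+1) (P \Po Q) :> R.
Proof.
rewrite comp_polyE rmorph_sum /= (@horner_coef_wide _ (size P)) ?size_poly //.
apply: eq_bigr => i _; rewrite coef_map -mul_polyC rmorphM rmorphXn /=.
congr (_ * _); have -> : (P`_i)%:P = (P`_i)%:~R :> {poly int}.
  by rewrite -[in LHS](intz P`_i) (rmorph_int (@polyC int)).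
by rewrite rmorph_int.
Qed.

Lemma coef_comp_polyNX (P : {poly int}) i : (P \Po - 'X)`_i = (-1) ^+ i * P`_i.
Proof.
rewrite comp_polyE (eq_bigr (fun j : 'I_(size P) => ((-1) ^+ j * P`_j) *: 'X^j)).
  rewrite coef_sumMXn (big_ord1_eq _ (fun j => (-1) ^+ j * P`_j)).
  by case: ltnP => // iP; rewrite nth_default ?mulr0.
by move=> j _; rewrite -scaleN1r exprZn scalerA mulrC.
Qed.

End TruncatedPolynomials.

Theorem theorem4p2 (P_sigma : fps int) (hP : fps_has_sum sigma_term P_sigma)
    (n : nat) :
  P_sigma (2 * n + 1)%N = (P_sigma_de n)%:Z - (P_sigma_do n)%:Z.
Proof.
(* in Z[X]/(X^(2n+2)) the element p = q^2 satisfies p^(n+1) = 0 *)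
pose K := (2 * n + 1)%N; pose A : comNzRingType := {poly %/ ('X^(K.+1) : {poly int})}.
pose q : A := in_qpoly 'X^(K.+1) 'X.
have qK : q ^+ K.+1 = 0 by exact: qpoly_nilX.
have pK : (q ^+ 2) ^+ K.+1 = 0 by rewrite -exprM mulnC exprM qK expr0n.
have pn : (q ^+ 2) ^+ n.+1 = 0 by rewrite -exprM -qK; congr (_ ^+ _); rewrite /K; lia.
have h1 := sigma_odd_prod qK.
have h2 := @part_eval_qprod A K.+1 (q ^+ 2) n pn isT ltac:(rewrite /K; lia).
have [v hv] : exists v, ((qprod K.+1 (q ^+ 2) 1 6) ^+ 2 *
  (qprod K.+1 (q ^+ 2) 3 6) ^+ 3 *
    (qprod K.+1 (q ^+ 2) 5 6) ^+ 2) * v = 1.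
  have [v1 u1] := @qprod_unit A K.+1 (q ^+ 2) pK 1 6 isT.
  have [v3 u3] := @qprod_unit A K.+1 (q ^+ 2) pK 3 6 isT.
  have [v5 u5] := @qprod_unit A K.+1 (q ^+ 2) pK 5 6 isT.
  exists (v1 ^+ 2 * v3 ^+ 3 * v5 ^+ 2).
  set a1 := qprod _ _ 1 6 in u1 *; set a3 := qprod _ _ 3 6 in u3 *.
  set a5 := qprod _ _ 5 6 in u5 *.
  transitivity ((a1 * v1) ^+ 2 * (a3 * v3) ^+ 3 * (a5 * v5) ^+ 2); first by ring.
  by rewrite u1 u3 u5 !expr1n !mulr1.
have h3 : sigma_at K.+1 q - sigma_at K.+1 (- q) = 2 * q * part_eval (q ^+ 2) n.
  apply: (unit_cancel hv); rewrite mulrC h1 -h2; ring.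
rewrite -(eval_sigma qK hP) -(eval_sigma (nilN qK) hP) in h3.
rewrite (fps_eval_trunc qK) (fps_eval_trunc (nilN qK)) in h3.
set F := \poly_(i < K.+1) P_sigma i in h3.
have qN : - q = in_qpoly 'X^(K.+1) (- 'X) by rewrite rmorphN.
have q2 : q ^+ 2 = in_qpoly 'X^(K.+1) ('X^2) by rewrite rmorphXn.
rewrite /part_eval qN q2 !horner_qpoly comp_polyXr in h3.
have h4 : in_qpoly 'X^(K.+1) (F - (F \Po - 'X)) =
    in_qpoly 'X^(K.+1) (2 * 'X * (part_gf n \Po 'X^2)).
  rewrite [LHS](rmorphB (in_qpoly 'X^(K.+1))); apply: etrans h3 _.
  by rewrite !rmorphM rmorph_nat.
have := in_qpoly_coef (ltnSn K) h4.
rewrite coefB -mulrA mulr_natl coefMn coefXM /K addn1 /=.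
have -> : (part_gf n \Po 'X^2)`_(2 * n) = (part_gf n)`_n.
  by rewrite coef_comp_poly_Xn // dvdn_mulr // mulKn.
rewrite coef_comp_polyNX exprS exprM sqrrN !expr1n mulr1 mulN1r opprK.
rewrite part_gf_coef coef_poly /K addn1 ltnSn; lia.
Qed.
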